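(* Let $M\ge1$ be an integer, $\tau>0$, and let $\vec W_M^{(0)}=(\rho_0,u_0,\theta_0,0,\dots,0)^T$ be a constant local equilibrium state with $\rho_0>0$, $|u_0|<1$, $\theta_0>0$. The moment system with Anderson–Witting source term is linearly stable both in space and in time at $\vec W_M^{(0)}$; that is, for the dispersion relation $$\det\left(i\omega\vec B_M^0-ik\vec B_M^1-\vec Q_M\right)\Big|_{\vec W_M^{(0)}}=0$$ of the linearized system: (time) for each $k\in\mathbb R$, every $\omega=\omega(k)\in\mathbb C$ satisfying it has $\operatorname{Im}\omega(k)\ge0$; (space) for each $\omega\in\mathbb R^+$, every $k=k(\omega)\in\mathbb C$ satisfying it has $\operatorname{Re}(k(\omega))\operatorname{Im}(k(\omega))\le0$.
   Context: Units: speed of light and particle rest mass equal to $1$; $i$ is the imaginary unit. **Orthogonal polynomials.** For $\zeta>0$ let $K_n(\zeta)=\int_0^\infty\cosh(n\vartheta)e^{-\zeta\cosh\vartheta}d\vartheta$. For $\ell\in\{0,1\}$ let $\omega^{(\ell)}(x;\zeta)=K_1(\zeta)^{-1}(x^2-1)^{\ell-1/2}e^{-\zeta x}$ on $[1,\infty)$ and $(f,g)_{\omega^{(\ell)}}=\int_1^\infty fg\,\omega^{(\ell)}dx$. $\{P_n^{(\ell)}(x;\zeta)\}_{n\ge0}$ are the orthonormal polynomials for $(\cdot,\cdot)_{\omega^{(\ell)}}$ ($\deg P^{(\ell)}_n=n$, leading coefficient $c_n^{(\ell)}>0$); $P_n^{(\ell)}$ has $n$ simple zeros $1<x_{1,n}^{(\ell)}<\dots<x_{n,n}^{(\ell)}$.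 Put $a_n^{(\ell)}=c_n^{(\ell)}/c_{n+1}^{(\ell)}$, $b_n^{(\ell)}=(xP_n^{(\ell)},P_n^{(\ell)})_{\omega^{(\ell)}}$, $p_n=c_n^{(0)}/c_n^{(1)}$, $q_n=\frac{c_n^{(1)}}{c_{n+1}^{(0)}}\big(\sum_{i=1}^{n+2}x_{i,n+2}^{(0)}-\sum_{i=1}^nx_{i,n}^{(1)}\big)$, $r_n=c_{n-1}^{(1)}/c_{n+1}^{(0)}$ ($n\ge1$). **Matrices.** $\vec J_n^{(\ell)}$ is the $(n+1)\times(n+1)$ symmetric tridiagonal matrix with diagonal $b_0^{(\ell)},\dots,b_n^{(\ell)}$ and off-diagonal $a_0^{(\ell)},\dots,a_{n-1}^{(\ell)}$. $\vec J_{n}$ is the $(n+1)\times(n+2)$ matrix whose entries (rows $k=0,\dots,n$, columns $j=0,\dots,n+1$) are $p_k$ at $(k,k)$, $q_k$ at $(k,k+1)$, $r_{k+1}$ at $(k,k+2)$ when $k+2\le n+1$, and $0$ otherwise. Define the $(2M+1)\times(2M+1)$ matrices $$\vec A_M^0=\begin{pmatrix}\vec J_M^{(0)}&0\\0&\vec J_{M-1}^{(1)}\end{pmatrix},\qquad \vec A_M^1=\begin{pmatrix}0&\vec J_{M-1}^T\\ \vec J_{M-1}&0\end{pmatrix}.$$ **Weighted basis.** For $|u|<1$, $\theta>0$ set $\zeta=1/\theta$, $U^0=(1-u^2)^{-1/2}$, $U^1=uU^0$; for $p\in\mathbb R$ set $p^0=\sqrt{1+p^2}$, $E=U^0p^0-U^1p$,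 $p_{<1>}=-p+U^1E$, $g_{[u,\theta]}=\frac1{2K_1(\zeta)}e^{-\zeta E}$. Let $\tilde P_k^{(0)}[u,\theta]=g_{[u,\theta]}P_k^{(0)}(E;\zeta)$, $\tilde P_k^{(1)}[u,\theta]=g_{[u,\theta]}P_k^{(1)}(E;\zeta)\,p_{<1>}/U^0$. Let $\vec{\mathcal P}_M=(\tilde P_0^{(0)},\tilde P_1^{(0)},\tilde P_0^{(1)},\tilde P_2^{(0)},\tilde P_1^{(1)},\dots,\tilde P_M^{(0)},\tilde P_{M-1}^{(1)})^T$; its components are orthonormal for $\langle f,h\rangle=\int_{\mathbb R}\frac{fh}{g_{[u,\theta]}}\frac{dp}{p^0}$. $\vec P_M^p$ is the permutation matrix with $\vec P_M^p(\tilde P_0^{(0)},\dots,\tilde P_M^{(0)},\tilde P_0^{(1)},\dots,\tilde P_{M-1}^{(1)})^T=\vec{\mathcal P}_M$. **Moment system (order $M$).** Unknowns: $\vec W_M=(\rho,u,\theta,\Pi,\tilde n^1,f_3^0,f_2^1,\dots,f_M^0,f_{M-1}^1)^T\in\mathbb R^{2M+1}$ ($\vec W_1=(\rho,u,\theta)^T$, $\vec W_2=(\rho,u,\theta,\Pi,\tilde n^1)^T$). To $\vec W_M$ associate $\vec f_M=(f_0^0,f_1^0,f_0^1,f_2^0,f_1^1,\dots,f_M^0,f_{M-1}^1)^T=\vec D_M^W\vec W_M$, where the matrix $\vec D_M^W=\vec D_M^W(\theta)$ is given by: for $M=1$, $\vec f_1=(\rho/c_0^{(0)},0,0)^T$;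 for $M\ge2$, $f_0^0=\rho/c_0^{(0)}-c_0^{(0)}\Pi$, $f_1^0=c_1^{(0)}x_{1,1}^{(0)}\Pi$, $f_0^1=-c_0^{(1)}\tilde n^1$, $f_2^0=-c_2^{(0)}x_{1,2}^{(0)}x_{2,2}^{(0)}\Pi$, $f_1^1=c_1^{(1)}x_{1,1}^{(1)}\tilde n^1$ (all coefficients at $\zeta=1/\theta$), the remaining components being those of $\vec W_M$. $\tilde{\vec D}_M^W$ is $\vec D_M^W$ with its upper left entry $1/c_0^{(0)}$ replaced by $0$. Let $F(\vec W_M;p)=\vec{\mathcal P}_M[u,\theta]^T\vec f_M$. $\vec D_M=\vec D_M(\vec W_M)$ is the $(2M+1)\times(2M+1)$ matrix with $(\vec D_M)_{kj}=\langle\partial F/\partial W_j,(\vec{\mathcal P}_M)_k\rangle$ (the coefficients of the orthogonal projection of $\partial F/\partial W_j$ on the span of $\vec{\mathcal P}_M$). Further $$\vec M_M^t=\vec P_M^p(U^0\vec A_M^0-U^1\vec A_M^1)(\vec P_M^p)^T,\quad \vec M_M^x=\vec P_M^p(U^1\vec A_M^0-U^0\vec A_M^1)(\vec P_M^p)^T,$$ $\vec B_M^0=\vec M_M^t\vec D_M$, $\vec B_M^1=\vec M_M^x\vec D_M$, $$\vec Q_M=-\frac1\tau\left(U^0\vec M_M^t-U^1\vec M_M^x\right)\tilde{\vec D}_M^W .$$ The moment system with Anderson–Witting source ($\tau$ the relaxation time) is $\vec B_M^0\partial_t\vec W_M+\vec B_M^1\partial_x\vec W_M=\vec S(\vec W_M)$,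 $\vec S(\vec W_M)=\vec Q_M\vec W_M$. Its linearization at $\vec W_M^{(0)}$ is $\vec B_M^0|_{\vec W_M^{(0)}}\partial_t\bar{\vec W}_M+\vec B_M^1|_{\vec W_M^{(0)}}\partial_x\bar{\vec W}_M=\vec Q_M|_{\vec W_M^{(0)}}\bar{\vec W}_M$; plane waves $\bar{\vec W}_M=\tilde{\vec W}_M e^{i(\omega t-kx)}$ with $\tilde{\vec W}_M\ne0$ give the dispersion relation in the claim. *)

(* Defs.v *)
From HB Require Import structures.
From mathcomp Require Import all_boot all_order all_algebra.
From mathcomp Require Import all_classical all_reals all_analysis.
From mathcomp Require Import polyrcf complex.

Set Implicit Arguments.
Unset Strict Implicit.
Unset Printing Implicit Defensive.

Import Order.TTheory GRing.Theory Num.Theory.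
Import numFieldNormedType.Exports.

Local Open Scope classical_set_scope.
Local Open Scope ring_scope.

Definition cosh {R : realType} (x : R) : R := (expR x + expR (- x)) / 2.

Definition besselK {R : realType} (n : nat) (zeta : R) : R :=
  \int[lebesgue_measure]_(t in `[0%R, +oo[)
     (cosh (n%:R * t) * expR (- (zeta * cosh t))).

(* At x = 1 and l = 0 the library value is 0 `^ (- 2^-1) = 0; this is one point. *)
Definition weight {R : realType} (l : nat) (zeta x : R) : R :=
  (besselK 1 zeta)^-1 * ((x ^+ 2 - 1) `^ (l%:R - 2^-1)) * expR (- (zeta * x)).

Definition weight_ip {R : realType} (l : nat) (zeta : R) (f g : {poly R}) : R :=
  \int[lebesgue_measure]_(x in `[1%R, +oo[) (f.[x] * g.[x] * weight l zeta x).

Definition orthonormal_family {R : realType} (l : nat) (zeta : R)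
    (P : nat -> {poly R}) : Prop :=
  [/\ forall n, size (P n) = n.+1,
      forall n, 0 < lead_coef (P n)
    & forall m n, weight_ip l zeta (P m) (P n) = (m == n)%:R].

(* For l = 0, 1 and zeta > 0 exactly one family satisfies
   [orthonormal_family l zeta]; the default value of [xget] is then irrelevant. *)
Definition orthopoly {R : realType} (l : nat) (zeta : R) : nat -> {poly R} :=
  xget (fun _ => 0) [set P : nat -> {poly R} | orthonormal_family l zeta P].

(* c_n^(l) *)
Definition lcoef {R : realType} (l : nat) (zeta : R) (n : nat) : R :=
  lead_coef (orthopoly l zeta n).

(* x_{i,n}^(l), for 1 <= i <= n: [rootsR] lists the real roots increasingly *)
Definition opzero {R : realType} (l : nat) (zeta : R) (i n : nat) : R :=
  nth 0 (rootsR (orthopoly l zeta n)) i.-1.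

Definition coef_a {R : realType} (l : nat) (zeta : R) (n : nat) : R :=
  lcoef l zeta n / lcoef l zeta n.+1.

Definition coef_b {R : realType} (l : nat) (zeta : R) (n : nat) : R :=
  weight_ip l zeta ('X * orthopoly l zeta n) (orthopoly l zeta n).

Definition coef_p {R : realType} (zeta : R) (n : nat) : R :=
  lcoef 0 zeta n / lcoef 1 zeta n.

Definition coef_q {R : realType} (zeta : R) (n : nat) : R :=
  lcoef 1 zeta n / lcoef 0 zeta n.+1 *
  (\sum_(1 <= i < n.+3) opzero 0 zeta i n.+2
   - \sum_(1 <= i < n.+1) opzero 1 zeta i n).

Definition coef_r {R : realType} (zeta : R) (n : nat) : R :=
  lcoef 1 zeta n.-1 / lcoef 0 zeta n.+1.

(* [jacobi_mx l zeta n] is J_{n-1}^(l): the parameter is the size *)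
Definition jacobi_mx {R : realType} (l : nat) (zeta : R) (n : nat) : 'M[R]_n :=
  \matrix_(i, j) if i == j :> nat then coef_b l zeta i
                 else if j == i.+1 :> nat then coef_a l zeta i
                 else if i == j.+1 :> nat then coef_a l zeta j
                 else 0.

(* [mixed_mx zeta n] is J_{n-1}, with n rows *)
Definition mixed_mx {R : realType} (zeta : R) (n : nat) : 'M[R]_(n, n.+1) :=
  \matrix_(k, j) if j == k :> nat then coef_p zeta k
                 else if j == k.+1 :> nat then coef_q zeta k
                 else if j == k.+2 :> nat then coef_r zeta k.+1
                 else 0.

(* the dimension 2M+1, in the form required by [block_mx] *)
Notation dimW M := (M.+1 + M)%N.

Definition A0_mx {R : realType} (M : nat) (zeta : R) : 'M[R]_(dimW M) :=
  block_mx (jacobi_mx 0 zeta M.+1) 0 0 (jacobi_mx 1 zeta M).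

Definition A1_mx {R : realType} (M : nat) (zeta : R) : 'M[R]_(dimW M) :=
  block_mx 0 (mixed_mx zeta M)^T (mixed_mx zeta M) 0.

Definition U0 {R : realType} (u : R) : R := (Num.sqrt (1 - u ^+ 2))^-1.
Definition U1 {R : realType} (u : R) : R := u * U0 u.
Definition p0 {R : realType} (p : R) : R := Num.sqrt (1 + p ^+ 2).
(* E *)
Definition energy {R : realType} (u p : R) : R := U0 u * p0 p - U1 u * p.
(* p_<1> *)
Definition p_proj {R : realType} (u p : R) : R := - p + U1 u * energy u p.

Definition gweight {R : realType} (u theta p : R) : R :=
  (2 * besselK 1 theta^-1)^-1 * expR (- (theta^-1 * energy u p)).

(* \tilde P_k^(l)[u, theta](p), for l = 0, 1 *)
Definition wpoly {R : realType} (l k : nat) (u theta p : R) : R :=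
  gweight u theta p * (orthopoly l theta^-1 k).[energy u p]
  * (p_proj u p / U0 u) ^+ l.

(* The pair (l, k) such that \tilde P_k^(l) is the i-th entry (from 0) of the
   interlaced vector P_M = (P_0^(0), P_1^(0), P_0^(1), P_2^(0), P_1^(1), ...). *)
Definition interlaced (i : nat) : nat * nat :=
  if (i == 0%N) || odd i then (0%N, uphalf i) else (1%N, (i./2).-1).

(* The same for (P_0^(0), ..., P_M^(0), P_0^(1), ..., P_(M-1)^(1)). *)
Definition stacked (M i : nat) : nat * nat :=
  if (i < M.+1)%N then (0%N, i) else (1%N, (i - M.+1)%N).

Definition basisM {R : realType} (M : nat) (i : 'I_(dimW M)) (u theta p : R) : R :=
  wpoly (interlaced i).1 (interlaced i).2 u theta p.

(* the permutation matrix taking the stacked vector to the interlaced one *)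
Definition Pp_mx {R : realType} (M : nat) : 'M[R]_(dimW M) :=
  \matrix_(i, j) (interlaced i == stacked M j)%:R.

Definition ip {R : realType} (u theta : R) (f h : R -> R) : R :=
  \int[lebesgue_measure]_(p in [set: R]) (f p * h p / gweight u theta p / p0 p).

Definition DW_entry {R : realType} (zeta : R) (i j : nat) : R :=
  match i, j with
  | 0, 0 => (lcoef 0 zeta 0)^-1
  | 0, 3 => - lcoef 0 zeta 0
  | 1, 3 => lcoef 0 zeta 1 * opzero 0 zeta 1 1
  | 2, 4 => - lcoef 1 zeta 0
  | 3, 3 => - (lcoef 0 zeta 2 * opzero 0 zeta 1 2 * opzero 0 zeta 2 2)
  | 4, 4 => lcoef 1 zeta 1 * opzero 1 zeta 1 1
  | _, _ => ((4 < i)%N && (i == j))%:R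
  end.

(* For M = 1 only the rows and columns 0, 1, 2 are present, and the only
   nonzero entry left is the upper left one. *)
Definition DW_mx {R : realType} (M : nat) (theta : R) : 'M[R]_(dimW M) :=
  \matrix_(i, j) DW_entry theta^-1 i j.

Definition DWt_mx {R : realType} (M : nat) (theta : R) : 'M[R]_(dimW M) :=
  \matrix_(i, j) if (i == 0%N :> nat) && (j == 0%N :> nat) then 0
                 else DW_mx M theta i j.

Definition velocity {R : realType} (M : nat) (W : 'cV[R]_(dimW M)) : R :=
  W (inord 1) 0.
Definition temperature {R : realType} (M : nat) (W : 'cV[R]_(dimW M)) : R :=
  W (inord 2) 0.

(* F(W; p) *)
Definition expansion {R : realType} (M : nat) (W : 'cV[R]_(dimW M)) (p : R) : R :=
  \sum_i basisM i (velocity W) (temperature W) p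
         * (DW_mx M (temperature W) *m W) i 0.

Definition D_mx {R : realType} (M : nat) (W : 'cV[R]_(dimW M)) : 'M[R]_(dimW M) :=
  \matrix_(k, j)
    ip (velocity W) (temperature W)
       (fun p => 'D_(delta_mx j 0) (fun V : 'cV[R]_(dimW M) => expansion V p) W)
       (basisM k (velocity W) (temperature W)).

Definition Mt_mx {R : realType} (M : nat) (u theta : R) : 'M[R]_(dimW M) :=
  Pp_mx M *m (U0 u *: A0_mx M theta^-1 - U1 u *: A1_mx M theta^-1)
  *m (Pp_mx M)^T.

Definition Mx_mx {R : realType} (M : nat) (u theta : R) : 'M[R]_(dimW M) :=
  Pp_mx M *m (U1 u *: A0_mx M theta^-1 - U0 u *: A1_mx M theta^-1)
  *m (Pp_mx M)^T.

Definition B0_mx {R : realType} (M : nat) (W : 'cV[R]_(dimW M)) : 'M[R]_(dimW M) :=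
  Mt_mx M (velocity W) (temperature W) *m D_mx W.

Definition B1_mx {R : realType} (M : nat) (W : 'cV[R]_(dimW M)) : 'M[R]_(dimW M) :=
  Mx_mx M (velocity W) (temperature W) *m D_mx W.

Definition Q_mx {R : realType} (M : nat) (tau : R) (W : 'cV[R]_(dimW M)) :
    'M[R]_(dimW M) :=
  - tau^-1 *:
  ((U0 (velocity W) *: Mt_mx M (velocity W) (temperature W)
    - U1 (velocity W) *: Mx_mx M (velocity W) (temperature W))
   *m DWt_mx M (temperature W)).

Definition equilibrium {R : realType} (M : nat) (rho u theta : R) :
    'cV[R]_(dimW M) :=
  \col_i match nat_of_ord i with
         | 0 => rho | 1 => u | 2 => theta | _ => 0
         end.

(* det (i omega B^0 - i k B^1 - Q), all matrices being evaluated at W *)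
Definition dispersion {R : realType} (M : nat) (tau : R) (W : 'cV[R]_(dimW M))
    (omega k : R[i]) : R[i] :=
  \det (('i%C * omega) *: map_mx (real_complex R) (B0_mx W)
        - ('i%C * k) *: map_mx (real_complex R) (B1_mx W)
        - map_mx (real_complex R) (Q_mx tau W)).

(* Main.v *)
Require Import Defs.
From HB Require Import structures.
From mathcomp Require Import all_boot all_order all_algebra.
From mathcomp Require Import all_classical all_reals all_analysis.
From mathcomp Require Import measurable_realfun.
From mathcomp Require Import polyrcf complex.
From mathcomp Require Import ring lra zify.

Set Implicit Arguments.
Unset Strict Implicit.
Unset Printing Implicit Defensive.

Import Order.TTheory GRing.Theory Num.Theory.
Import numFieldNormedType.Exports.

Local Open Scope ring_scope.

(** Why the theorem holds.

    Write [T = M^t] and [X = M^x] for the matrices of multiplication by p^0 and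
    p on the span of the weighted basis, [D] for [D_M] at the equilibrium, and
    [N] for the diagonal projection that erases the first three unknowns
    (density, velocity, temperature).  Since (U^0)^2 - (U^1)^2 = 1, the matrix
    [A = U^0 T - U^1 X] is that of multiplication by the energy E, and at an
    equilibrium the matrix of the source is [Q = - tau^-1 A D N].  If [v] is the
    amplitude of a plane wave, testing the linearized system against [D v]
    gives one scalar equation

      i omega m - i k x + r = 0,

    where [m] and [x] are the values at [D v] of the Hermitian forms of [T] and
    [X], and [r] is [tau^-1] times the value at [v] of the form of [D^T A D N].
    Suppose that [T] is positive definite, that [D] is invertible, and that
    [D^T A D N] is symmetric and nonnegative.  Then [m > 0], [r >= 0] and [x] is
    real.  For real [k] this gives Im omega = r / m >= 0.  For real omega > 0 it
    gives [x <> 0] and [k = (omega m - i r) / x], so that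
    Re k Im k = - omega m r / x^2 <= 0.  This part is [dispersion_scalar],
    [scalar_stability_time] and [scalar_stability_space].

    The three properties are verified as follows.

    - [T] is positive definite ([time_form_gt0]).  A vector represents a pair of
      polynomials [(f, g)], and its value under [T] is U^0 times the integral of
      E f^2 + E (E^2 - 1) g^2 - 2 u (E^2 - 1) f g against the weight, which is
      positive because |u| < 1 and (E^2 - 1)^2 <= E^2 (E^2 - 1).  That the
      entries of the matrices, given by leading coefficients and zeros, are the
      expected moments is [jacobi_mxE] and [mixed_mxE].  The zeros enter through
      Vieta formulas, for which P_n must have n simple real zeros
      ([orthonormal_zeros]): it has no divisor of degree at least 1 that is
      nonnegative on [1, oo), since a cofactor [r] would have degree below n
      and yet satisfy (P_n, r) > 0.

    - [D^T A D N] is symmetric and nonnegative ([relaxation_symmetric]).  This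
      amounts to [A]-orthogonality of the first three columns of [D] to the
      others, that is to the Landau matching conditions
      ([Landau_orthogonality]).  The coefficients attached to the pressure and
      the heat flux are those of minus a reproducing kernel at 0
      ([reproducing_at0]), and the latter annihilates every multiple of the
      variable of low degree.

    - [D] is invertible ([equilibrium_det]).  At an equilibrium the expansion
      is rho g.  Its derivative in u is a multiple of the weighted P_0^(1), and
      its derivative in theta is a combination of the weighted P_0^(0) and
      P_1^(0) ([derivative_expansion]); orthonormality of the basis then gives
      the entries of [D] ([D_mx_equilibrium]).

    All integrals are brought to one half line.  The substitution E = cosh t
    turns both weights into exp (- zeta cosh t) times a power of sinh t
    ([weight_ipE]), and p = U^1 cosh t + U^0 sinh t does the same for the inner
    product in momentum space ([kinetic_ip]). *)

(** * Dispersion relations and quadratic forms *)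

Definition quad {R : comNzRingType} n (S : 'M[R]_n) (v : 'cV[R]_n) : R :=
  (v^T *m S *m v) 0 0.

Section HermitianForm.
Variables (R : rcfType) (n : nat).
Implicit Types (S : 'M[R]_n) (v : 'cV[R[i]]_n).

Local Notation toC := (map_mx (real_complex R)).

Definition herm S v : R[i] := ((map_mx conjc v)^T *m toC S *m v) 0 0.

(** For a real symmetric matrix the cross terms between real and imaginary
    parts cancel, so the Hermitian form takes real values. *)
Lemma herm_quad S v : S^T = S ->
  herm S v = (quad S (map_mx (@complex.Re R) v)
              + quad S (map_mx (@complex.Im R) v))%:C%C.
Proof.
move=> symS; rewrite /herm /quad -!mulmxA !mxE.
rewrite rmorphD !rmorph_sum /=.
have -> : \sum_j (map_mx conjc v)^T 0 j * (toC S *m v) j 0 =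
  \sum_i \sum_j conjc (v i 0) * ((S i j)%:C)%C * v j 0.
  apply: eq_bigr => i _; rewrite !mxE mulr_sumr; apply: eq_bigr => j _.
  by rewrite !mxE mulrA.
have quadE w : \sum_i ((w^T 0 i * (S *m w) i 0)%:C)%C =
  \sum_i \sum_j ((w i 0 * S i j * w j 0)%:C)%C.
  apply: eq_bigr => i _; rewrite !mxE mulr_sumr rmorph_sum /=.
  by apply: eq_bigr => j _; rewrite mulrA.
rewrite !quadE.
(* Doubling the sum pairs the entries (i, j) and (j, i), whose cross terms
   are conjugate. *)
have two_neq0 : (2%:R : R[i]) != 0 by rewrite pnatr_eq0.
apply: (mulfI two_neq0); rewrite !mulr_natl !mulr2n {1}exchange_big /= -!big_split /=.
apply: eq_bigr => i _; rewrite -!big_split /=; apply: eq_bigr => j _.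
have -> : S j i = S i j by rewrite -{1}symS mxE.
rewrite !mxE; case: (v i 0) => a b; case: (v j 0) => c d /=.
by apply/eqP; simpc; rewrite eq_complex /=; apply/andP; split; apply/eqP; ring.
Qed.

Lemma re_im_eq0 v : map_mx (@complex.Re R) v = 0 ->
  map_mx (@complex.Im R) v = 0 -> v = 0.
Proof.
move=> re0 im0; apply/matrixP => i j.
move/matrixP/(_ i j): re0; move/matrixP/(_ i j): im0.
by rewrite !mxE; case: (v i j) => a b /= -> ->.
Qed.

(** The plane wave amplitude [v] solving the linearized system, tested against
    [D v], turns the dispersion relation into a scalar equation whose three
    coefficients are the values of real quadratic forms.  [E] selects the
    variables that relax; the compatibility hypothesis says that the relaxation
    operator is self-adjoint for [A], hence it contributes a nonnegative
    number. *)
Lemma dispersion_scalar (T X A D E : 'M[R]_n) (s : R) (omega k : R[i]) :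
  T^T = T -> X^T = X -> A^T = A ->
  (forall v : 'cV[R]_n, v != 0 -> 0 < quad T v) ->
  (forall v : 'cV[R]_n, 0 <= quad A v) ->
  \det D != 0 -> D^T *m A *m D *m E = E^T *m (D^T *m A *m D *m E) ->
  0 <= s ->
  \det (('i%C * omega) *: toC (T *m D) - ('i%C * k) *: toC (X *m D)
        + toC (s *: (A *m D *m E))) = 0 ->
  exists m x r : R, [/\ 0 < m, 0 <= r
    & 'i%C * omega * m%:C%C - 'i%C * k * x%:C%C + r%:C%C = 0].
Proof.
move=> symT symX symA posT posA detD comp s0 /eqP; set Z := (X in \det X).
rewrite -det_tr => /det0P[u u0 /(congr1 trmx)].
rewrite trmx_mul trmxK trmx0; set v := u^T => Zv.
have v0 : v != 0 by rewrite -trmx_eq0 trmxK.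
have [w wE] : {w | w = toC D *m v} by exists (toC D *m v).
have DC : toC D \in unitmx.
  by rewrite unitmxE det_map_mx unitfE fmorph_eq0.
have w0 : w != 0.
  apply: contra_neq v0 => w0.
  by rewrite -(mulKmx DC v) -wE w0 mulmx0.
have symTw := herm_quad w symT; have symXw := herm_quad w symX.
have quad_pos : 0 < quad T (map_mx (@complex.Re R) w)
              + quad T (map_mx (@complex.Im R) w).
  have quad_ge0 y : 0 <= quad T y.
    have [->|/posT/ltW//] := eqVneq y 0.
    by rewrite /quad mulmx0 mxE.
  have [re0|re0] := eqVneq (map_mx (@complex.Re R) w) 0; last first.
    by rewrite ltr_pwDl// posT.
  have [im0|im0] := eqVneq (map_mx (@complex.Im R) w) 0; last first.
    by rewrite ltr_wpDl// posT.
  by case/eqP: w0; exact: re_im_eq0.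
have [y yE] : {y | y = toC E *m v} by exists (toC E *m v).
exists (quad T (map_mx (@complex.Re R) w) + quad T (map_mx (@complex.Im R) w)).
exists (quad X (map_mx (@complex.Re R) w) + quad X (map_mx (@complex.Im R) w)).
exists (s * (quad A (map_mx (@complex.Re R) (toC D *m y))
        + quad A (map_mx (@complex.Im R) (toC D *m y)))).
split=> //; first by rewrite mulr_ge0 // addr_ge0.
rewrite -symTw -symXw rmorphM /= -(herm_quad _ symA).
transitivity (((map_mx conjc w)^T *m (Z *m v)) 0 0); last by rewrite Zv mulmx0 mxE.
rewrite /Z mulmxDl mulmxBl mulmxDr mulmxBr -!scalemxAl -!scalemxAr.
rewrite !map_mxM map_mxZ !map_mxM -scalemxAl -!mulmxA -wE -yE -scalemxAr.
rewrite /herm.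
have cj m1 m2 p (M : 'M[R]_(m1, m2)) (N : 'M[R[i]]_(m2, p)) :
   map_mx conjc (map_mx (real_complex R) M *m N) =
     map_mx (real_complex R) M *m map_mx conjc N.
  rewrite map_mxM; congr (_ *m _); apply/matrixP => i j; rewrite !mxE.
  by apply/eqP; rewrite eq_complex /= oppr0 !eqxx.
have -> : (map_mx conjc (toC D *m y))^T *m toC A *m (toC D *m y) =
          (map_mx conjc w)^T *m (toC A *m (toC D *m y)).
  rewrite yE wE (cj _ _ _ D (toC E *m v)) (cj _ _ _ E v) (cj _ _ _ D v).
  rewrite (trmx_mul (toC D)) (trmx_mul (toC E)) (trmx_mul (toC D)).
  rewrite -!(mulmxA (map_mx conjc v)^T); congr (_ *m _).
  have compC := congr1 (map_mx (real_complex R)) comp.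
  rewrite !map_mxM /= -!map_trmx -!mulmxA in compC.
  by rewrite !mulmxA in compC *; rewrite -compC.
rewrite -!mulmxA.
move: (_ *m (toC T *m w)) (_ *m (toC X *m w)) (_ *m (toC A *m _)) => P1 P2 P3.
by rewrite !mxE.
Qed.

End HermitianForm.

(** The equation reads [omega m = k x + i r]. *)
Lemma scalar_stability_time (R : rcfType) (m x r k : R) (omega : R[i]) :
  0 < m -> 0 <= r ->
  'i%C * omega * m%:C%C - 'i%C * k%:C%C * x%:C%C + r%:C%C = 0 ->
  0 <= complex.Im omega.
Proof.
case: omega => a b m0 r0 /eqP; simpc; rewrite eq_complex /= => /andP[/eqP e _].
by rewrite -(pmulr_lge0 _ m0); lra.
Qed.

(** The equation reads [k x = omega m - i r] with [omega m > 0], which forces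
    [x <> 0]. *)
Lemma scalar_stability_space (R : rcfType) (m x r omega : R) (k : R[i]) :
  0 < m -> 0 <= r -> 0 < omega ->
  'i%C * omega%:C%C * m%:C%C - 'i%C * k * x%:C%C + r%:C%C = 0 ->
  complex.Re k * complex.Im k <= 0.
Proof.
case: k => a b m0 r0 w0 /eqP; simpc; rewrite eq_complex /=.
move=> /andP[/eqP e1 /eqP e2].
have ax : a * x = omega * m by lra.
have bx : b * x = - r by lra.
have x0 : x != 0.
  by apply: contraTneq (mulr_gt0 w0 m0) => x0; rewrite -ax x0 mulr0 ltxx.
rewrite -(pmulr_lle0 _ (_ : 0 < x ^+ 2)); last by rewrite exprn_even_gt0.
have -> : a * b * x ^+ 2 = (a * x) * (b * x) by ring.
by rewrite ax bx mulrN oppr_le0 !mulr_ge0// ltW.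
Qed.

(** * Orthonormal polynomials of a positive functional *)

(** Positivity is asked for all polynomials nonnegative on [[1, oo)], not only
    for squares: the factors [X] and [X^2 - 1] that occur below change sign on
    the real line. *)
Definition positive_on_ray {R : realDomainType} (lam : {poly R} -> R) : Prop :=
  forall q : {poly R}, q != 0 -> (forall x, 1 <= x -> 0 <= q.[x]) -> 0 < lam q.

Definition orthonormal_for {R : realDomainType} (lam : {poly R} -> R)
    (P : nat -> {poly R}) : Prop :=
  [/\ forall n, size (P n) = n.+1,
      forall n, 0 < lead_coef (P n)
    & forall m n, lam (P m * P n) = (m == n)%:R].

Section GramSchmidt.
Variables (R : rcfType) (lam : {scalar {poly R}}).
Hypothesis lam_pos : positive_on_ray lam.

Lemma lam_sqr_gt0 (q : {poly R}) : q != 0 -> 0 < lam (q * q).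
Proof.
move=> q0; apply: lam_pos; first by rewrite mulf_neq0.
by move=> x _; rewrite hornerM -expr2 sqr_ge0.
Qed.

Definition residual (s : seq {poly R}) : {poly R} :=
  'X^(size s) - \sum_(p <- s) lam ('X^(size s) * p) *: p.

Definition normalized (q : {poly R}) : {poly R} :=
  (Num.sqrt (lam (q * q)))^-1 *: q.

(** The family is built as the list of its first members, because each step
    uses all the previous ones. *)
Definition gram_schmidt_seq n : seq {poly R} :=
  iter n (fun s => rcons s (normalized (residual s))) [::].

Definition gram_schmidt n := normalized (residual (gram_schmidt_seq n)).

Lemma gram_schmidt_seqE n : gram_schmidt_seq n = mkseq gram_schmidt n.
Proof. by elim: n => // n IH; rewrite mkseqS -IH. Qed.

Lemma residualE n : residual (gram_schmidt_seq n) =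
  'X^n - \sum_(i < n) lam ('X^n * gram_schmidt i) *: gram_schmidt i.
Proof.
rewrite /residual gram_schmidt_seqE size_mkseq big_map.
rewrite -(big_mkord xpredT (fun i => lam ('X^n * gram_schmidt i) *: gram_schmidt i)).
by rewrite /index_iota subn0.
Qed.

Lemma gram_schmidtE n : exists a, gram_schmidt n =
  a *: ('X^n - \sum_(i < n) lam ('X^n * gram_schmidt i) *: gram_schmidt i).
Proof. by rewrite -residualE; eexists. Qed.

Lemma residual_orthogonal (P : nat -> {poly R}) n (p q : {poly R}) :
  (forall k m, (k < n)%N -> (m < n)%N -> lam (P k * P m) = (k == m)%:R) ->
  (exists a, p = a *: (q - \sum_(i < n) lam (q * P i) *: P i)) ->
  forall k, (k < n)%N -> lam (P k * p) = 0.
Proof.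
move=> orthP [a ->] k kn; rewrite -scalerAr linearZ /= mulrBr linearB /=.
rewrite mulr_sumr linear_sum /= (bigD1 (Ordinal kn)) //=.
rewrite -scalerAr linearZ /= orthP // eqxx mulr1.
rewrite big1 ?addr0; first by rewrite [P k * q]mulrC subrr mulr0.
move=> i /negPf ik; rewrite -scalerAr linearZ /= orthP // eq_sym.
by rewrite -val_eqE /= in ik; rewrite ik mulr0.
Qed.

Lemma gram_schmidt_orthonormal : orthonormal_for lam gram_schmidt.
Proof.
have main n : [/\ forall k, (k < n)%N -> size (gram_schmidt k) = k.+1,
    forall k, (k < n)%N -> 0 < lead_coef (gram_schmidt k)
  & forall k m, (k < n)%N -> (m < n)%N ->
      lam (gram_schmidt k * gram_schmidt m) = (k == m)%:R].
  elim: n => [|n [IHs IHl IHo]]; first by split.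
  have resE := residualE n.
  have size_sum :
      (size (- \sum_(i < n) lam ('X^n * gram_schmidt i) *: gram_schmidt i)
       < size ('X^n : {poly R}))%N.
    rewrite size_polyN size_polyXn ltnS.
    apply: (leq_trans (size_sum _ _ _)); apply/bigmax_leqP => i _.
    by rewrite (leq_trans (size_scale_leq _ _)) // IHs.
  have size_res : size (residual (gram_schmidt_seq n)) = n.+1.
    by rewrite resE size_polyDl // size_polyXn.
  have lead_res : lead_coef (residual (gram_schmidt_seq n)) = 1.
    by rewrite resE lead_coefDl // lead_coefXn.
  have res0 : residual (gram_schmidt_seq n) != 0.
    by rewrite -size_poly_eq0 size_res.
  have norm_gt0 := lam_sqr_gt0 res0.
  have sqrt_gt0 : 0 < Num.sqrt (lam (residual (gram_schmidt_seq n)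
                                     * residual (gram_schmidt_seq n))).
    by rewrite sqrtr_gt0.
  have orth_n k : (k < n)%N -> lam (gram_schmidt k * gram_schmidt n) = 0.
    exact: residual_orthogonal IHo (gram_schmidtE n) k.
  have ltS k : (k < n.+1)%N -> (k < n)%N \/ k = n.
    by rewrite ltnS leq_eqVlt => /predU1P[->|]; [right|left].
  split.
  - move=> k /ltS[/IHs//|->].
    by rewrite size_scale ?size_res // invr_eq0 gt_eqF.
  - move=> k /ltS[/IHl//|->].
    by rewrite lead_coefZ lead_res mulr1 invr_gt0.
  - move=> k m /ltS[kn|->] /ltS[mn|->].
    + exact: IHo.
    + by rewrite orth_n // ltn_eqF.
    + by rewrite mulrC orth_n // gtn_eqF.
    + rewrite eqxx /gram_schmidt /normalized -scalerAl -scalerAr !linearZ /=.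
      rewrite mulrA -invfM -expr2 sqr_sqrtr ?mulVf ?gt_eqF //.
      exact: ltW.
split.
- by move=> n; have [+ _ _] := main n.+1; apply.
- by move=> n; have [_ + _] := main n.+1; apply.
- move=> m n; have [_ _ +] := main (maxn m n).+1; apply.
  + by rewrite ltnS leq_maxl.
  + by rewrite ltnS leq_maxr.
Qed.

End GramSchmidt.

Section RealRooted.
Variable R : rcfType.

(** A nonreal root and its conjugate give a divisor [(X - a)^2 + b^2] with
    [b != 0], and a double real root gives one with [b = 0].  Without such
    divisors the roots are therefore real and simple. *)
Lemma real_rooted_factor (p : {poly R}) : p != 0 ->
  (forall a b r, p != r * (('X - a%:P) ^+ 2 + (b ^+ 2)%:P)) ->
  p = lead_coef p *: \prod_(z <- rootsR p) ('X - z%:P).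
Proof.
move=> p0 no_factor.
have rootsP x : root p x = (x \in rootsR p).
  by have := roots_on_rootsR p0 x; rewrite in_itv /= => <-.
have [q pE] : exists q, p = q * \prod_(z <- rootsR p) ('X - z%:P).
  apply: uniq_roots_prod_XsubC; first by apply/allP => x; rewrite rootsP.
  by rewrite uniq_rootsE uniq_roots.
suff /eqP/size_poly1P[c c0 qE] : size q = 1%N.
  rewrite [LHS]pE qE mul_polyC; congr (_ *: _).
  rewrite pE qE mul_polyC lead_coefZ (monicP _) ?mulr1 //.
  exact: monic_prod_XsubC.
apply/eqP; apply/negPn/negP.
rewrite -(size_map_poly (real_complex R)) => /closed_rootP[[a b] qz].
pose d : {poly R} := ('X - a%:P) ^+ 2 + (b ^+ 2)%:P.
have [b0|b0] := eqVneq b 0.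
  have qa : root q a.
    by move: qz; rewrite b0 (fmorph_root (real_complex R)).
  have aroot : a \in rootsR p by rewrite -rootsP pE rootM qa.
  have [t tE] : exists t, \prod_(z <- rootsR p) ('X - z%:P) = t * ('X - a%:P).
    by rewrite (big_rem a) //=; eexists; rewrite mulrC.
  have /factor_theorem[s sE] := qa.
  have /eqP[] := no_factor a 0 (s * t).
  by rewrite expr0n addr0 {1}pE sE tE; ring.
suff /eqP dq : q %% d == 0.
  have /eqP[] := no_factor a b (q %/ d * \prod_(z <- rootsR p) ('X - z%:P)).
  by rewrite {1}pE {1}(divp_eq q d) dq addr0 -/d; ring.
have sd : size d = 3%N.
  rewrite /d size_polyDl ?size_exp_XsubC //.
  exact: leq_ltn_trans (size_polyC_leq1 _) _.
have d0 : d != 0 by rewrite -size_poly_eq0 sd.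
have := ltn_modp q d; rewrite d0 sd ltnS.
move: qz; rewrite {1}(divp_eq q d) rmorphD rmorphM /= rootE hornerD hornerM.
have [m <-] : {m : {poly R} | m = q %% d} by exists (q %% d).
have -> : (map_poly (real_complex R) d).[a +i* b]%C = 0.
  rewrite /d rmorphD rmorphXn /= rmorphB /= map_polyX !map_polyC /= !hornerE /=.
  have -> : ((a +i* b) - a%:C = 0 +i* b)%C.
    by apply/eqP; rewrite eq_complex /= subrr subr0 !eqxx.
  by rewrite expr2; simpc; rewrite -expr2 addNr.
rewrite mulr0 add0r => mz sm.
have mE : m = (m`_0)%:P + m`_1 *: 'X.
  apply/polyP => i; rewrite coefD coefC coefZ coefX.
  case: i => [|[|i]] /=; rewrite ?mulr0 ?mulr1 ?addr0 ?add0r //.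
  by rewrite nth_default // (leq_trans sm).
move: mz; rewrite mE rmorphD /= map_polyZ map_polyX map_polyC /= !hornerE.
rewrite eq_complex; simpc => /andP[/eqP re0 /eqP im0].
have m1 : m`_1 = 0.
  by move/eqP: im0; rewrite mulf_eq0 (negPf b0) orbF => /eqP.
have m00 : m`_0 = 0 by move: re0; rewrite m1 mul0r addr0.
by rewrite m1 m00 scale0r addr0.
Qed.

End RealRooted.

Section OrthonormalFamily.
Variables (R : rcfType) (lam : {scalar {poly R}}) (P : nat -> {poly R}).
Hypothesis P_orth : orthonormal_for lam P.

Let sizeP n : size (P n) = n.+1.
Proof. by have [+ _ _] := P_orth; apply. Qed.

Let leadP n : 0 < lead_coef (P n).
Proof. by have [_ + _] := P_orth; apply. Qed.

Let lamP m n : lam (P m * P n) = (m == n)%:R.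
Proof. by have [_ _ +] := P_orth; apply. Qed.

Lemma size_cancel_top n (q : {poly R}) : (size q <= n.+1)%N ->
  (size (q - (q`_n / lead_coef (P n)) *: P n)%R <= n)%N.
Proof.
move=> sq; apply/leq_sizeP => j nj; rewrite coefB coefZ.
have [jn|jn] := eqVneq j n.
  rewrite jn; have -> : (P n)`_n = lead_coef (P n) by rewrite lead_coefE sizeP.
  by rewrite divfK ?subrr // gt_eqF.
have nj' : (n.+1 <= j)%N by rewrite ltn_neqAle eq_sym jn.
rewrite (nth_default _ (leq_trans sq nj')) [(P n)`_j]nth_default ?sizeP //.
by rewrite mulr0 subrr.
Qed.

Lemma orthonormal_span n (q : {poly R}) : (size q <= n)%N ->
  exists a : nat -> R, q = \sum_(i < n) a i *: P i.
Proof.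
elim: n q => [|n IH] q sq.
  by exists (fun=> 0); rewrite big_ord0; apply/eqP; rewrite -size_poly_leq0.
pose r := q - (q`_n / lead_coef (P n)) *: P n.
have sr : (size r <= n)%N by exact: size_cancel_top.
have [a ra] := IH r sr.
exists (fun i => if (i == n)%N then q`_n / lead_coef (P n) else a i).
rewrite big_ord_recr /= eqxx -[LHS](subrK ((q`_n / lead_coef (P n)) *: P n)) -/r.
rewrite {1}ra; congr (_ + _); apply: eq_bigr => i _.
by rewrite ltn_eqF.
Qed.

Lemma orthonormal_expansion n (q : {poly R}) : (size q <= n)%N ->
  q = \sum_(i < n) lam (q * P i) *: P i.
Proof.
move=> /orthonormal_span[a qE]; rewrite [LHS]qE; apply: eq_bigr => i _.
rewrite qE mulr_suml linear_sum /= (bigD1 i) //= -scalerAl linearZ /= lamP.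
rewrite eqxx mulr1 big1 ?addr0 // => j /negPf ji.
by rewrite -scalerAl linearZ /= lamP; rewrite -val_eqE /= in ji; rewrite ji mulr0.
Qed.

(** A polynomial of degree below [n] is a combination of the members of
    index below [n], all orthogonal to [P n]. *)
Lemma orthonormal_low n (q : {poly R}) : (size q <= n)%N -> lam (q * P n) = 0.
Proof.
move=> /orthonormal_span[a ->]; rewrite mulr_suml linear_sum /= big1 // => i _.
by rewrite -scalerAl linearZ /= lamP ltn_eqF ?mulr0.
Qed.

Lemma orthonormal_top n (q : {poly R}) : (size q <= n.+1)%N ->
  lam (q * P n) = q`_n / lead_coef (P n).
Proof.
move=> sq; pose r := q - (q`_n / lead_coef (P n)) *: P n.
have sr : (size r <= n)%N by exact: size_cancel_top.
rewrite -[q in LHS](subrK ((q`_n / lead_coef (P n)) *: P n)) -/r mulrDl linearD /=.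
by rewrite orthonormal_low // add0r -scalerAl linearZ /= lamP eqxx mulr1.
Qed.

Section Zeros.
Hypothesis lam_pos : positive_on_ray lam.

(** If [P n = r d], then [lam (P n * r) = lam (r^2 d)] is positive, although
    [r] has degree below [n].  This replaces the usual count of sign changes. *)
Lemma no_nonneg_factor n (d r : {poly R}) : (1 < size d)%N ->
  (forall x, 1 <= x -> 0 <= d.[x]) -> P n != r * d.
Proof.
move=> sd d0; apply/eqP => PE.
have Pn0 : P n != 0 by rewrite -size_poly_eq0 sizeP.
have r0 : r != 0 by apply: contra_neq Pn0 => r0; rewrite PE r0 mul0r.
have dn0 : d != 0 by apply: contra_neq Pn0 => dn0; rewrite PE dn0 mulr0.
have sr : (size r <= n)%N.
  rewrite -ltnS -(sizeP n) PE size_mul // -subn1 ltn_subRL addnC.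
  by rewrite -addnS leq_add2l.
have := orthonormal_low sr; rewrite PE => /eqP; rewrite gt_eqF //.
apply: lam_pos; first by rewrite !mulf_neq0.
by move=> x /d0 dx; rewrite !hornerM mulrA mulr_ge0 // -expr2 sqr_ge0.
Qed.

(** The zeros lie beyond 1: the divisor [X] is excluded because it is
    nonnegative on [[1, oo)]. *)
Lemma orthonormal_at0_neq0 n : (P n).[0] != 0.
Proof.
apply/negP => /factor_theorem[r]; rewrite subr0; apply/eqP.
apply: no_nonneg_factor; first by rewrite size_polyX.
by move=> x x1; rewrite hornerX (le_trans ler01).
Qed.

Lemma orthonormal_zeros n :
  P n = lead_coef (P n) *: \prod_(z <- rootsR (P n)) ('X - z%:P).
Proof.
apply: real_rooted_factor; first by rewrite -size_poly_eq0 sizeP.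
move=> a b r; apply: no_nonneg_factor.
  rewrite size_polyDl.
    by rewrite size_exp_XsubC.
  by rewrite size_exp_XsubC (leq_ltn_trans (size_polyC_leq1 _)).
by move=> x _; rewrite !hornerE addr_ge0 // sqr_ge0.
Qed.

Lemma size_orthonormal_zeros n : size (rootsR (P n)) = n.
Proof.
apply: succn_inj; rewrite -(size_prod_XsubC _ id).
rewrite -(size_scale (a := lead_coef (P n))); last by rewrite gt_eqF.
by rewrite -orthonormal_zeros sizeP.
Qed.

Lemma orthonormal_coef_pred n :
  (P n.+1)`_n = - (lead_coef (P n.+1) * \sum_(z <- rootsR (P n.+1)) z).
Proof.
rewrite {1}orthonormal_zeros coefZ -mulrN; congr (_ * _).
by rewrite -coefPn_prod_XsubC size_orthonormal_zeros.
Qed.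

Lemma orthonormal_at0 n : (P n).[0] =
  (-1) ^+ n * (lead_coef (P n) * \prod_(z <- rootsR (P n)) z).
Proof.
rewrite horner_coef0 {1}orthonormal_zeros coefZ coef0_prod_XsubC.
by rewrite size_orthonormal_zeros mulrCA.
Qed.

End Zeros.
End OrthonormalFamily.

(** * The moment matrices as quadratic forms on polynomials *)

Lemma interlaced_inj : injective interlaced.
Proof.
by move=> i j; rewrite /interlaced; case: ifP => hi; case: ifP => hj [] //; lia.
Qed.

Lemma stacked_inj M : injective (stacked M).
Proof.
by move=> i j; rewrite /stacked; case: ifP => hi; case: ifP => hj [] //; lia.
Qed.

Lemma interlaced_stacked M (i : 'I_(dimW M)) :
  exists a : 'I_(dimW M), interlaced i = stacked M a.
Proof.
have iM := ltn_ord i; rewrite /interlaced; case: ifP => hi.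
  have aM : (uphalf i < dimW M)%N by lia.
  by exists (Ordinal aM); rewrite /stacked /= ifT //; lia.
have aM : (M.+1 + (i./2).-1 < dimW M)%N by lia.
exists (Ordinal aM); rewrite /stacked /= ifF; last by lia.
by congr pair; lia.
Qed.

(** Conjugation by the permutation matrix only relabels the entries, so the
    moment matrices can be computed in the interlaced labelling. *)
Lemma Pp_conj {R : realType} M (Y : 'M[R]_(dimW M)) (i j a b : 'I_(dimW M)) :
  interlaced i = stacked M a -> interlaced j = stacked M b ->
  (Pp_mx M *m Y *m (Pp_mx M)^T) i j = Y a b.
Proof.
move=> ia jb; rewrite mxE (bigD1 b) //= [X in _ + X]big1 ?addr0; last first.
  move=> k kb; rewrite [X in _ * X]mxE [X in _ * X]mxE jb.
  by rewrite (inj_eq (@stacked_inj M)) val_eqE eq_sym (negPf kb) mulr0.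
rewrite [X in _ * X]mxE [X in _ * X]mxE jb eqxx mulr1.
rewrite mxE (bigD1 a) //= [X in _ + X]big1 ?addr0; last first.
  move=> k ka; rewrite [X in X * _]mxE ia.
  by rewrite (inj_eq (@stacked_inj M)) val_eqE eq_sym (negPf ka) mul0r.
by rewrite [X in X * _]mxE ia eqxx mul1r.
Qed.

Lemma sum_nth_predn {R : nmodType} (s : seq R) :
  \sum_(1 <= i < (size s).+1) nth 0 s i.-1 = \sum_(z <- s) z.
Proof. by rewrite [RHS](big_nth 0) big_add1. Qed.

Section LorentzFactor.
Variable R : realType.

Lemma gamma_gt0 (u : R) : `|u| < 1 -> 0 < U0 u.
Proof.
move=> u1; rewrite /U0 invr_gt0 sqrtr_gt0 subr_gt0.
by rewrite -real_normK ?num_real // expr_lt1.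
Qed.

Lemma gamma_sqr (u : R) : `|u| < 1 -> U0 u ^+ 2 - U1 u ^+ 2 = 1.
Proof.
move=> u1; rewrite /U1 exprMn -{1}[U0 u ^+ 2]mul1r -mulrBl /U0 exprVn sqr_sqrtr.
  by rewrite mulfV // gt_eqF // subr_gt0 -real_normK ?num_real // expr_lt1.
by rewrite ltW // subr_gt0 -real_normK ?num_real // expr_lt1.
Qed.

End LorentzFactor.

Section MomentAlgebra.
Variables (R : realType) (zeta : R) (Lam : nat -> {scalar {poly R}}).
Hypothesis weightE : forall l f g, (l < 2)%N ->
  weight_ip l zeta f g = Lam l (f * g).
Hypothesis Lam1E : forall q, Lam 1 q = Lam 0 (q * ('X^2 - 1)).
Hypothesis Lam0_pos : positive_on_ray (Lam 0).

Local Notation P l n := (orthopoly l zeta n).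

Lemma Lam_pos l : (l < 2)%N -> positive_on_ray (Lam l).
Proof.
case: l => [|[|//]] _ // q q0 qpos; rewrite Lam1E; apply: Lam0_pos.
  by rewrite mulf_neq0 // -size_poly_eq0 size_XnsubC.
move=> x x1; rewrite hornerM mulr_ge0 ?qpos // !hornerE subr_ge0.
by rewrite expr_ge1 // (le_trans ler01).
Qed.

Lemma orthopoly_orthonormal l : (l < 2)%N ->
  orthonormal_for (Lam l) (orthopoly l zeta).
Proof.
move=> l2.
have : orthonormal_family l zeta (orthopoly l zeta).
  rewrite /orthopoly; apply: (@xgetPex _ _ [set Q | orthonormal_family l zeta Q]).
  exists (gram_schmidt (Lam l)).
  have [sP lP oP] := gram_schmidt_orthonormal (Lam_pos l2).
  by split=> // m n; rewrite weightE.
by case=> sP lP oP; split=> // m n; rewrite -weightE.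
Qed.

Let orth0 := orthopoly_orthonormal (isT : (0 < 2)%N).
Let orth1 := orthopoly_orthonormal (isT : (1 < 2)%N).

Lemma size_orthopoly l n : (l < 2)%N -> size (P l n) = n.+1.
Proof. by move=> /orthopoly_orthonormal[+ _ _]; apply. Qed.

Lemma lcoef_gt0 l n : (l < 2)%N -> 0 < lcoef l zeta n.
Proof. by move=> /orthopoly_orthonormal[_ + _]; apply. Qed.

Lemma lcoef_neq0 l n : (l < 2)%N -> lcoef l zeta n != 0.
Proof. by move=> l2; rewrite gt_eqF // lcoef_gt0. Qed.

Lemma orthopoly0E l : (l < 2)%N -> P l 0 = (lcoef l zeta 0)%:P.
Proof.
move=> l2; rewrite /lcoef lead_coefE size_orthopoly //=.
by apply: size1_polyC; rewrite size_orthopoly.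
Qed.

Lemma orthopoly_top l n : (l < 2)%N -> (P l n)`_n = lcoef l zeta n.
Proof. by move=> l2; rewrite /lcoef lead_coefE size_orthopoly. Qed.

Lemma orthopoly_neq0 l n : (l < 2)%N -> P l n != 0.
Proof. by move=> l2; rewrite -size_poly_eq0 size_orthopoly. Qed.

(** The three-term recurrence: [X P_i] has degree [i + 1], so the moment
    vanishes beyond the first off-diagonal. *)
Lemma jacobi_mxE l n (i j : 'I_n) : (l < 2)%N ->
  jacobi_mx l zeta n i j = Lam l ('X * P l i * P l j).
Proof.
move=> l2; have orth := orthopoly_orthonormal l2.
have offdiag (k m : nat) : (k < m)%N ->
    Lam l ('X * P l k * P l m) = if m == k.+1 then coef_a l zeta k else 0.
  move=> km; case: eqP => [->|mk].
    rewrite (orthonormal_top orth) ?coefXM /=.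
      by rewrite orthopoly_top.
    by rewrite mulrC size_mulX ?size_orthopoly // -size_poly_eq0 size_orthopoly.
  rewrite (orthonormal_low orth) // mulrC size_mulX ?size_orthopoly //; first lia.
  by rewrite -size_poly_eq0 size_orthopoly.
rewrite mxE; case: (ltngtP i j) => [ij|ji|ij].
- by rewrite offdiag //; case: eqP => // _; case: eqP => //; lia.
- rewrite mulrAC offdiag //; case: eqP => [|_]; first lia.
  by case: eqP.
- by rewrite /coef_b weightE // -ij.
Qed.

Lemma sum_opzero l n : (l < 2)%N ->
  \sum_(1 <= i < n.+1) opzero l zeta i n = \sum_(z <- rootsR (P l n)) z.
Proof.
move=> l2; rewrite -sum_nth_predn.
by rewrite (size_orthonormal_zeros (orthopoly_orthonormal l2) (Lam_pos l2)).
Qed.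

Lemma orthopoly_coef_pred l n : (l < 2)%N -> (P l n.+1)`_n =
  - (lcoef l zeta n.+1 * \sum_(1 <= i < n.+2) opzero l zeta i n.+1).
Proof.
move=> l2; rewrite sum_opzero //.
exact: (orthonormal_coef_pred (orthopoly_orthonormal l2) (Lam_pos l2)).
Qed.

(** Below the diagonal and on it the moment is read in weight 1, where
    [P 0 j] is expanded on the family [P 1].  Above, it is read in weight 0,
    where [h = (X^2 - 1) P 1 k] is expanded on the family [P 0]; its degree
    [k + 2] bounds the band. *)
Lemma mixed_mxE n (k : 'I_n) (j : 'I_n.+1) :
  mixed_mx zeta n k j = Lam 1 (P 1 k * P 0 j).
Proof.
pose h := P 1 k * ('X^2 - 1).
have h_neq0 : P 1 k != 0 by exact: orthopoly_neq0.
have sh : size h = k.+3.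
  rewrite /h size_mul //; last by rewrite -size_poly_eq0 size_XnsubC.
  by rewrite size_XnsubC // size_orthopoly //; lia.
have hE m : h`_m = (if (m < 2)%N then 0 else (P 1 k)`_(m - 2)) - (P 1 k)`_m.
  by rewrite /h mulrBr mulr1 coefB coefMXn.
have LamhE m : Lam 1 (P 1 k * P 0 m) = Lam 0 (h * P 0 m).
  by rewrite Lam1E /h mulrAC.
have h_top : h`_k.+2 = lcoef 1 zeta k.
  rewrite hE /= -[k.+2]addn2 addnK orthopoly_top // [_`_(k + 2)]nth_default ?subr0 //.
  by rewrite size_orthopoly //; lia.
rewrite mxE; case: eqP => [->|jk].
  rewrite mulrC (orthonormal_top orth1) ?size_orthopoly //.
  by rewrite orthopoly_top.
(* On the first superdiagonal the top term of h is removed first; the next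
   coefficient of the difference is a difference of sums of zeros. *)
case: eqP => [->|jk1].
  rewrite LamhE; pose r := h - (lcoef 1 zeta k / lcoef 0 zeta k.+2) *: P 0 k.+2.
  have sr : (size r <= k.+2)%N.
    rewrite /r -h_top /lcoef -[h`__]/(h`_k.+2).
    by apply: (size_cancel_top orth0); rewrite sh.
  have -> : h = r + (lcoef 1 zeta k / lcoef 0 zeta k.+2) *: P 0 k.+2 by rewrite subrK.
  rewrite mulrDl linearD /= -scalerAl linearZ /=.
  have [_ _ ->] := orth0; rewrite gtn_eqF // mulr0 addr0.
  rewrite (orthonormal_top orth0) // coefB coefZ orthopoly_coef_pred // hE.
  have -> : (P 1 k)`_k.+1 = 0 by rewrite nth_default // size_orthopoly.
  have -> : (if (k.+1 < 2)%N then 0 else (P 1 k)`_(k.+1 - 2)) =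
      - (lcoef 1 zeta k * \sum_(1 <= i < k.+1) opzero 1 zeta i k).
    case: (nat_of_ord k) => [|m] /=; first by rewrite big_geq // mulr0 oppr0.
    by rewrite !subSS subn0 orthopoly_coef_pred.
  rewrite /coef_q -/(lcoef 0 zeta k.+1).
  by field; rewrite !lcoef_neq0.
case: eqP => [->|jk2].
  rewrite LamhE (orthonormal_top orth0) ?sh // h_top.
  by rewrite /coef_r.
case: (ltngtP j k) => [lt_jk|lt_kj|//].
  by rewrite mulrC (orthonormal_low orth1) ?size_orthopoly.
by rewrite LamhE (orthonormal_low orth0) // sh; lia.
Qed.

(** A pair [(f, g)] of polynomials encodes the field
    g_{[u,theta]} (f(E) + g(E) p_<1> / U^0).  The entry of index [a] of the
    weighted basis is encoded by [(comp0 a, comp1 a)]. *)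
Definition comp0 (a : nat * nat) : {poly R} := if a.1 == 0%N then P 0 a.2 else 0.
Definition comp1 (a : nat * nat) : {poly R} := if a.1 == 0%N then 0 else P 1 a.2.

(** The bilinear forms of multiplication by E and by p_<1> / U^0 on fields:
    since (p_<1> / U^0)^2 = E^2 - 1, the product of two second components is
    integrated in weight 1. *)
Definition energy_form (f g h k : {poly R}) : R :=
  Lam 0 ('X * f * h) + Lam 1 ('X * g * k).
Definition flux_form (f g h k : {poly R}) : R := Lam 1 (g * h + f * k).

Lemma stacked_lshift M (i : 'I_M.+1) : stacked M (lshift M i) = (0%N, nat_of_ord i).
Proof. by rewrite /stacked /= ltn_ord. Qed.

Lemma stacked_rshift M (i : 'I_M) : stacked M (rshift M.+1 i) = (1%N, nat_of_ord i).
Proof. by rewrite /stacked /= ltnNge leq_addr /= addKn. Qed.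

Lemma A0_mxE M (i j : 'I_(dimW M)) (a := stacked M i) (b := stacked M j) :
  A0_mx M zeta i j = energy_form (comp0 a) (comp1 a) (comp0 b) (comp1 b).
Proof.
rewrite /a /b /energy_form /A0_mx /comp0 /comp1.
case: (split_ordP i) => {a}i -> ; case: (split_ordP j) => {b}j ->;
  rewrite ?stacked_lshift ?stacked_rshift /=.
- by rewrite block_mxEul jacobi_mxE // !mulr0 linear0 addr0.
- by rewrite block_mxEur mxE !mulr0 mul0r !linear0 addr0.
- by rewrite block_mxEdl mxE !mulr0 mul0r !linear0 addr0.
- by rewrite block_mxEdr jacobi_mxE // !mulr0 linear0 add0r.
Qed.

Lemma A1_mxE M (i j : 'I_(dimW M)) (a := stacked M i) (b := stacked M j) :
  A1_mx M zeta i j = flux_form (comp0 a) (comp1 a) (comp0 b) (comp1 b).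
Proof.
rewrite /a /b /flux_form /A1_mx /comp0 /comp1.
case: (split_ordP i) => {a}i -> ; case: (split_ordP j) => {b}j ->;
  rewrite ?stacked_lshift ?stacked_rshift /=.
- by rewrite block_mxEul mxE mulr0 mul0r addr0 linear0.
- by rewrite block_mxEur mxE mixed_mxE mul0r add0r mulrC.
- by rewrite block_mxEdl mixed_mxE mulr0 addr0.
- by rewrite block_mxEdr mxE mulr0 mul0r addr0 linear0.
Qed.

Lemma Pp_lin_conj M c d (i j : 'I_(dimW M)) (a := interlaced i) (b := interlaced j) :
  (Pp_mx M *m (c *: A0_mx M zeta - d *: A1_mx M zeta) *m (Pp_mx M)^T) i j =
  c * energy_form (comp0 a) (comp1 a) (comp0 b) (comp1 b)
  - d * flux_form (comp0 a) (comp1 a) (comp0 b) (comp1 b).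
Proof.
have [k ak] := interlaced_stacked i; have [m bm] := interlaced_stacked j.
have lin (A B : 'M[R]_(dimW M)) : (c *: A - d *: B) k m = c * A k m - d * B k m.
  by rewrite !mxE.
by rewrite (Pp_conj _ ak bm) lin A0_mxE A1_mxE /a /b ak bm.
Qed.

Definition field0 M (v : 'cV[R]_(dimW M)) : {poly R} :=
  \sum_i v i 0 *: comp0 (interlaced i).
Definition field1 M (v : 'cV[R]_(dimW M)) : {poly R} :=
  \sum_i v i 0 *: comp1 (interlaced i).

Lemma sum_bilinear n (lam : {scalar {poly R}}) (c : {poly R})
    (v w : 'cV[R]_n) (F G : 'I_n -> {poly R}) :
  lam (c * (\sum_i v i 0 *: F i) * (\sum_i w i 0 *: G i)) =
  \sum_i \sum_j v i 0 * w j 0 * lam (c * F i * G j).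
Proof.
rewrite [X in lam (X * _)]mulr_sumr mulr_suml linear_sum /=.
apply: eq_bigr => i _; rewrite mulr_sumr linear_sum /=; apply: eq_bigr => j _.
by rewrite -!scalerAr -scalerAl scalerA linearZ /= [w _ _ * _]mulrC.
Qed.

Lemma bilinear_Pp_conj M c d (v w : 'cV[R]_(dimW M)) :
  (v^T *m (Pp_mx M *m (c *: A0_mx M zeta - d *: A1_mx M zeta) *m (Pp_mx M)^T)
   *m w) 0 0 =
  c * energy_form (field0 v) (field1 v) (field0 w) (field1 w)
  - d * flux_form (field0 v) (field1 v) (field0 w) (field1 w).
Proof.
set K := (X in _ *m X *m _).
transitivity (\sum_i \sum_j v i 0 * w j 0 * K i j).
  rewrite -mulmxA mxE; apply: eq_bigr => i _; rewrite !mxE mulr_sumr.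
  by apply: eq_bigr => j _; rewrite -mulrA [K i j * _]mulrC.
rewrite /energy_form /flux_form -[field1 v * _]mul1r -[field0 v * field1 w]mul1r.
rewrite linearD /= !mulrA !sum_bilinear -!big_split /= !mulr_sumr -sumrB.
apply: eq_bigr => i _; rewrite -!big_split /= !mulr_sumr -sumrB.
apply: eq_bigr => j _.
by rewrite Pp_lin_conj /energy_form /flux_form !mul1r linearD /=; ring.
Qed.

Lemma field_eq0 M (v : 'cV[R]_(dimW M)) : field0 v = 0 -> field1 v = 0 -> v = 0.
Proof.
move=> f0 g0; apply/matrixP => i j; rewrite ord1 mxE.
have injE (k : 'I_(dimW M)) : (interlaced k == interlaced i) = (k == i).
  by rewrite (inj_eq interlaced_inj) val_eqE.
case ia : (interlaced i) => [l n]; have [l0|l0] := eqVneq l 0%N.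
  have := congr1 (fun q => Lam 0 (q * P 0 n)) f0.
  rewrite /= mul0r linear0 mulr_suml linear_sum /= (bigD1 i) //=.
  have [_ _ oP] := orth0.
  rewrite -scalerAl linearZ /= {1}/comp0 ia l0 /= oP eqxx mulr1.
  rewrite big1 ?addr0 // => k ki; rewrite -scalerAl linearZ /= /comp0.
  case: eqP => k0; last by rewrite mul0r linear0 mulr0.
  rewrite oP; case: eqP => kn; last by rewrite mulr0.
  by move: ki; rewrite -injE [interlaced k]surjective_pairing k0 kn ia l0 eqxx.
have := congr1 (fun q => Lam 1 (q * P 1 n)) g0.
rewrite /= mul0r linear0 mulr_suml linear_sum /= (bigD1 i) //=.
have [_ _ oP] := orth1.
have l_1 (k : nat) a b : interlaced k = (a, b) -> a != 0%N -> a = 1%N.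
  by rewrite /interlaced; case: ifP => _ [<- _].
rewrite -scalerAl linearZ /= {1}/comp1 ia (negPf l0) /= oP eqxx mulr1.
rewrite big1 ?addr0 // => k ki; rewrite -scalerAl linearZ /= /comp1.
case: eqP => k0; first by rewrite mul0r linear0 mulr0.
rewrite oP; case: eqP => kn; last by rewrite mulr0.
have k1 := l_1 _ _ _ (surjective_pairing (interlaced k)) (introN eqP k0).
move: ki; rewrite -injE [interlaced k]surjective_pairing k1 kn ia.
by rewrite (l_1 _ _ _ ia l0) eqxx.
Qed.

Lemma Lam_X_sqr_gt0 l (q : {poly R}) : (l < 2)%N -> q != 0 ->
  0 < Lam l ('X * q * q).
Proof.
move=> l2 q0; apply: (Lam_pos l2); first by rewrite !mulf_neq0 // polyX_eq0.
move=> x x1; rewrite !hornerM hornerX -mulrA -expr2 mulr_ge0 ?sqr_ge0 //.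
exact: le_trans x1.
Qed.

Lemma energy_form_gt0 f g : (f != 0) || (g != 0) -> 0 < energy_form f g f g.
Proof.
rewrite /energy_form.
have [->|f0] := eqVneq f 0; have [->|g0] //= := eqVneq g 0 => _.
- by rewrite mulr0 linear0 add0r Lam_X_sqr_gt0.
- by rewrite [X in _ + Lam 1 X]mulr0 linear0 addr0 Lam_X_sqr_gt0.
- by rewrite addr_gt0 ?Lam_X_sqr_gt0.
Qed.

Lemma energy_form_ge0 f g : 0 <= energy_form f g f g.
Proof.
case: (boolP ((f != 0) || (g != 0))) => [/energy_form_gt0/ltW //|].
rewrite negb_or !negbK => /andP[/eqP -> /eqP ->].
by rewrite /energy_form mulr0 !linear0 addr0.
Qed.

(** Multiplied by [x], the integrand
    [x f^2 + x (x^2 - 1) g^2 + 2 s (x^2 - 1) f g] becomes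
    [(x f + s (x^2 - 1) g)^2 + (x^2 - 1) g^2] when [s^2 = 1]. *)
Lemma flux_le_energy (s : R) f g : s ^+ 2 = 1 ->
  0 <= energy_form f g f g + s * flux_form f g f g.
Proof.
move=> s2.
pose q : {poly R} := 'X * f * f + 'X * ('X^2 - 1) * g * g
  + s *: (('X^2 - 1) * f * g) *+ 2.
have -> : energy_form f g f g + s * flux_form f g f g = Lam 0 q.
  rewrite /energy_form /flux_form /q !Lam1E -linearZ /= -!linearD /=; congr (Lam 0 _).
  by rewrite -!mul_polyC; ring.
have [->|q0] := eqVneq q 0; first by rewrite linear0.
apply/ltW/Lam0_pos => // x x1; have x0 : 0 < x by rewrite (lt_le_trans ltr01).
rewrite -(pmulr_rge0 _ x0).
have -> : x * q.[x] =
  (x * f.[x] + s * (x ^+ 2 - 1) * g.[x]) ^+ 2 + (x ^+ 2 - 1) * g.[x] ^+ 2 +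
  (1 - s ^+ 2) * ((x ^+ 2 - 1) ^+ 2 * g.[x] ^+ 2).
  by rewrite /q !hornerE /=; ring.
rewrite s2 subrr mul0r addr0 addr_ge0 ?sqr_ge0 // mulr_ge0 ?sqr_ge0 //.
by rewrite subr_ge0; nra.
Qed.

(** The flux form is at most the energy form in absolute value, and the
    factor [u] makes the inequality strict. *)
Lemma time_form_gt0 u f g : `|u| < 1 -> (f != 0) || (g != 0) ->
  0 < energy_form f g f g - u * flux_form f g f g.
Proof.
move=> u1 /energy_form_gt0.
have := flux_le_energy f g (expr1n _ 2).
have := flux_le_energy f g (_ : (-1) ^+ 2 = 1); rewrite sqrrN expr1n => /(_ erefl).
move: u1; rewrite ltr_norml => /andP[].
move: (energy_form _ _ _ _) (flux_form _ _ _ _) => e m un1 u1 em ep e0.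
have [u0|u0] := leP 0 u; first by nra.
by nra.
Qed.

(** The sum is the reproducing kernel at 0 of the polynomials of degree
    below [n]. *)
Lemma reproducing_at0 l n (q : {poly R}) : (l < 2)%N -> (size q <= n)%N ->
  Lam l (q * \sum_(k < n) (P l k).[0] *: P l k) = q.[0].
Proof.
move=> l2 sq; rewrite mulr_sumr linear_sum /=.
rewrite [in RHS](orthonormal_expansion (orthopoly_orthonormal l2) sq).
rewrite horner_sum; apply: eq_bigr => k _.
by rewrite -scalerAr linearZ hornerZ /= mulrC.
Qed.

Lemma orthopoly1_at0 l : (l < 2)%N ->
  (P l 1).[0] = - (lcoef l zeta 1 * opzero l zeta 1 1).
Proof.
move=> l2.
rewrite (orthonormal_at0 (orthopoly_orthonormal l2) (Lam_pos l2)) expr1 mulN1r.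
have := size_orthonormal_zeros (orthopoly_orthonormal l2) (Lam_pos l2) 1.
by rewrite /opzero; case: (rootsR _) => [|z [|]] //= _; rewrite big_seq1.
Qed.

Lemma orthopoly2_at0 l : (l < 2)%N ->
  (P l 2).[0] = lcoef l zeta 2 * opzero l zeta 1 2 * opzero l zeta 2 2.
Proof.
move=> l2; rewrite (orthonormal_at0 (orthopoly_orthonormal l2) (Lam_pos l2)).
rewrite sqrrN expr1n mul1r.
have := size_orthonormal_zeros (orthopoly_orthonormal l2) (Lam_pos l2) 2.
rewrite /opzero; case: (rootsR _) => [|z [|y [|]]] //= _.
by rewrite big_cons big_seq1 mulrA.
Qed.

Lemma orthopoly_at0_neq0 l n : (l < 2)%N -> (P l n).[0] != 0.
Proof.
by move=> l2; exact: (orthonormal_at0_neq0 (orthopoly_orthonormal l2) (Lam_pos l2)).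
Qed.

(** The entries of D_M at an equilibrium.  The derivative of the expansion in
    u is [a] times the weighted P_0^(1), and its derivative in theta is [b]
    times the weighted P_0^(0) plus [c] times the weighted P_1^(0); the other
    unknowns enter linearly, through D^W. *)
Definition equilibrium_entry (a b c : R) (i j : nat) : R :=
  match j with
  | 1 => if i == 2 then a else 0
  | 2 => if i == 0 then b else if i == 1 then c else 0
  | _ => DW_entry zeta i j
  end.

Lemma sum_first5 (V : nmodType) N (F : nat -> V) : (4 < N)%N ->
  (forall k, (4 < k)%N -> F k = 0) ->
  \sum_(k < N) F k = F 0%N + F 1%N + F 2%N + F 3%N + F 4%N.
Proof.
move=> N4 F0; rewrite -(big_mkord xpredT F) (@big_cat_nat _ _ _ 5) //=.
rewrite [X in _ + X]big_nat_cond [X in _ + X]big1 ?addr0.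
  by rewrite !big_nat_recr //= big_geq // add0r.
by move=> k /andP[/andP[k5 _] _]; rewrite F0.
Qed.

Section EquilibriumMatrix.
Variables (M : nat) (D : 'M[R]_(dimW M)) (a b c : R).
Hypothesis DE : forall i j, D i j = equilibrium_entry a b c i j.

(** The unknowns of index at least 3 vanish at every local equilibrium; they
    are the ones that the source term drives to 0. *)
Definition relaxing : 'M[R]_(dimW M) := \matrix_(i, j) ((i == j) && (2 < j)%N)%:R.

(** If [D u = 0], the rows give in turn the unknowns of index above 4, then
    those of index 3 and 4, then the velocity, the temperature and the
    density: each row then contains a single unknown that is not yet known
    to vanish.  The pivots of index 3 and 4 are values of orthonormal
    polynomials at 0. *)
Lemma equilibrium_det : (0 < M)%N -> a != 0 -> c != 0 -> \det D != 0.
Proof.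
move=> M_gt0 a_neq0 c_neq0.
rewrite -det_tr; apply/det0P => -[u u0].
move=> /(congr1 trmx); rewrite trmx_mul trmxK trmx0 => Du0.
have row i : \sum_j D i j * u 0 j = 0.
  move/matrixP/(_ i 0): Du0; rewrite !mxE => e; rewrite -[RHS]e.
  by apply: eq_bigr => j _; rewrite mxE.
have pivot (i j : 'I_(dimW M)) : D i j != 0 ->
    (forall k, k != j -> D i k = 0 \/ u 0 k = 0) -> u 0 j = 0.
  move=> Dij other; have := row i; rewrite (bigD1 j) //= big1 ?addr0.
    by move=> /eqP; rewrite mulf_eq0 (negPf Dij) => /eqP.
  by move=> k /other[->|->]; rewrite ?mul0r ?mulr0.
have high (j : 'I_(dimW M)) : (4 < j)%N -> u 0 j = 0.
  move=> j4; apply: (pivot j) => [|k kj].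
    rewrite DE; move: j4; case: (nat_of_ord j) => [|[|[|[|[|m]]]]] //= _.
    by rewrite eqxx oner_neq0.
  left; rewrite -val_eqE /= in kj; rewrite DE; move: j4 kj.
  case: (nat_of_ord j) => [|[|[|[|[|m]]]]] // _.
  case: (nat_of_ord k) => [|[|[|[|[|n]]]]] //= kj.
  by rewrite eq_sym (negPf kj).
have u3 (j : 'I_(dimW M)) : nat_of_ord j = 3 -> u 0 j = 0.
  move=> j3; apply: (pivot j) => [|k].
    rewrite DE j3 /= -(orthopoly2_at0 (isT : (0 < 2)%N)) oppr_eq0.
    exact: orthopoly_at0_neq0.
  rewrite -val_eqE /= DE j3 => k3.
  by case: (ltnP 4 k) => [/high|]; [right|move: k3;
    case: (nat_of_ord k) => [|[|[|[|[|n]]]]] //=; left].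
have u4 (j : 'I_(dimW M)) : nat_of_ord j = 4 -> u 0 j = 0.
  move=> j4; apply: (pivot j) => [|k].
    rewrite DE j4 /= -[_ * _]opprK -(orthopoly1_at0 (isT : (1 < 2)%N)) oppr_eq0.
    exact: orthopoly_at0_neq0.
  rewrite -val_eqE /= DE j4 => k4.
  by case: (ltnP 4 k) => [/high|]; [right|move: k4;
    case: (nat_of_ord k) => [|[|[|[|[|n]]]]] //=; left].
have big3 (j : 'I_(dimW M)) : (2 < j)%N -> u 0 j = 0.
  move=> j2; case: (ltngtP 4 j) => [/high //|j4|/esym /u4 //].
  by apply: u3; lia.
have low (i j : nat) (iM : (i < dimW M)%N) (jM : (j < dimW M)%N) :
    (j < 3)%N -> equilibrium_entry a b c i j != 0 ->
    (forall k, (k < 3)%N -> k != j -> equilibrium_entry a b c i k = 0 \/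
       forall kM : (k < dimW M)%N, u 0 (Ordinal kM) = 0) ->
    u 0 (Ordinal jM) = 0.
  move=> j3 ej other; apply: (pivot (Ordinal iM)) => [|k kj]; first by rewrite DE.
  have [k3|k3] := ltnP k 3; last by right; exact: big3.
  have [] := other k k3 _; first by rewrite -val_eqE in kj.
    by left; rewrite DE.
  by case: k {kj k3} => k kM uk; right; rewrite uk.
have M0 : (0 < dimW M)%N by lia.
have M1 : (1 < dimW M)%N by lia.
have M2 : (2 < dimW M)%N by lia.
have u_1 : u 0 (Ordinal M1) = 0.
  by apply: (low 2 1 M2) => //= -[|[|[|]]] //=; left.
have u_2 : u 0 (Ordinal M2) = 0.
  by apply: (low 1 2 M1) => //= -[|[|[|]]] //=; left.
have u_0 : u 0 (Ordinal M0) = 0.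
  apply: (low 0 0 M0) => //=; first by rewrite invr_eq0 lcoef_neq0.
  move=> [|[|[|]]] //= _ _; first by left.
  by right=> kM; rewrite -u_2; congr (u 0 _); exact: val_inj.
case/eqP: u0; apply/matrixP => i j; rewrite ord1 mxE.
have [/big3 //|] := ltnP 2 j.
case: j => [[|[|[|]]]] // jM _.
- by rewrite -u_0; congr (u 0 _); exact: val_inj.
- by rewrite -u_1; congr (u 0 _); exact: val_inj.
- by rewrite -u_2; congr (u 0 _); exact: val_inj.
Qed.

Lemma high_moments_orthogonal (i j : nat) : (i < 3)%N -> (4 < j)%N ->
  energy_form (comp0 (interlaced i)) (comp1 (interlaced i))
    (comp0 (interlaced j)) (comp1 (interlaced j)) = 0.
Proof.
move=> i3 j4.
have low l k m : (l < 2)%N -> (k.+1 < m)%N -> Lam l ('X * P l k * P l m) = 0.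
  move=> l2 km; rewrite (orthonormal_low (orthopoly_orthonormal l2)) //.
  by rewrite mulrC size_mulX ?size_orthopoly ?orthopoly_neq0.
case: i i3 => [|[|[|//]]] _; rewrite /energy_form /comp0 /comp1 /interlaced /=;
  case hj: ((j == 0%N) || odd j) => /=;
    rewrite !(mulr0, mul0r, linear0, add0r, addr0) ?low //; lia.
Qed.

(** The fields of the relaxing unknowns.  For the pressure and the heat flux
    the coefficients are minus the values at 0 of the polynomials that they
    multiply, hence the reproducing kernels. *)
Definition entry_field0 (j : nat) : {poly R} :=
  match j with
  | 3 => - \sum_(k < 3) (P 0 k).[0] *: P 0 k
  | 4 => 0
  | _ => comp0 (interlaced j)
  end.

Definition entry_field1 (j : nat) : {poly R} :=
  match j with
  | 3 => 0
  | 4 => - \sum_(k < 2) (P 1 k).[0] *: P 1 k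
  | _ => comp1 (interlaced j)
  end.

Lemma col_fields (j : 'I_(dimW M)) : (2 < j)%N ->
  field0 (col j D) = entry_field0 j /\ field1 (col j D) = entry_field1 j.
Proof.
move=> j2; rewrite /field0 /field1.
under eq_bigr do rewrite mxE DE.
under [X in _ /\ X = _]eq_bigr do rewrite mxE DE.
have jM := ltn_ord j; have [j4|j4] := ltnP 4 j.
  have other (k : 'I_(dimW M)) : equilibrium_entry a b c k j = (k == j)%:R.
    move: j4; rewrite -val_eqE /=; case: (nat_of_ord j) => [|[|[|[|[|m]]]]] // _.
    by case: (nat_of_ord k) => [|[|[|[|[|n]]]]].
  have sumE (F : nat -> {poly R}) :
      \sum_(k < dimW M) equilibrium_entry a b c k j *: F k = F j.
    rewrite (bigD1 j) //= other eqxx scale1r big1 ?addr0 // => k /negPf kj.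
    by rewrite other kj scale0r.
  rewrite (sumE (fun k => comp0 (interlaced k))).
  rewrite (sumE (fun k => comp1 (interlaced k))).
  by move: j4; case: (nat_of_ord j) => [|[|[|[|[|m]]]]].
have M5 : (4 < dimW M)%N by lia.
have small (k m : nat) : (4 < k)%N -> (m < 5)%N -> (2 < m)%N ->
  equilibrium_entry a b c k m = 0.
  by case: m => [|[|[|[|[|]]]]] //; case: k => [|[|[|[|[|]]]]].
have sumE (F : nat -> {poly R}) :
    \sum_(k < dimW M) equilibrium_entry a b c k j *: F k =
    equilibrium_entry a b c 0 j *: F 0%N + equilibrium_entry a b c 1 j *: F 1%N
    + equilibrium_entry a b c 2 j *: F 2%N + equilibrium_entry a b c 3 j *: F 3%N
    + equilibrium_entry a b c 4 j *: F 4%N.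
  apply: (@sum_first5 _ _ (fun k => equilibrium_entry a b c k j *: F k)) => //.
  by move=> k k4; rewrite small ?scale0r.
rewrite (sumE (fun k => comp0 (interlaced k))) (sumE (fun k => comp1 (interlaced k))).
have [j3|j3] : nat_of_ord j = 3 \/ nat_of_ord j = 4 by lia.
  rewrite j3 /= /comp0 /comp1 /= !(scaler0, scale0r, addr0, add0r); split=> //.
  rewrite !big_ord_recr big_ord0 /= add0r orthopoly1_at0 // orthopoly2_at0 //.
  by rewrite (orthopoly0E (isT : (0 < 2)%N)) hornerC !opprD !scaleNr opprK.
rewrite j3 /= /comp0 /comp1 /= !(scaler0, scale0r, addr0, add0r); split=> //.
rewrite !big_ord_recr big_ord0 /= add0r orthopoly1_at0 //.
by rewrite (orthopoly0E (isT : (1 < 2)%N)) hornerC !opprD !scaleNr opprK.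
Qed.

(** The three equilibrium directions are the members of degree 0 and 1 of the
    first family and of degree 0 of the second.  Against the kernels of the
    pressure and of the heat flux, [X] times such a member is evaluated at 0,
    where it vanishes.  The other columns have too large a degree. *)
Lemma Landau_orthogonality (A := Pp_mx M *m A0_mx M zeta *m (Pp_mx M)^T)
    (i j : 'I_(dimW M)) : (i < 3)%N -> (2 < j)%N -> (A *m D) i j = 0.
Proof.
move=> i3 j2.
have -> : (A *m D) i j = ((delta_mx i 0 : 'cV[R]_(dimW M))^T *m A *m col j D) 0 0.
  by rewrite trmx_delta -mulmxA -rowE colE mulmxA -colE [RHS]mxE [RHS]mxE.
have -> : A = Pp_mx M *m (1 *: A0_mx M zeta - 0 *: A1_mx M zeta) *m (Pp_mx M)^T.
  by rewrite scale1r scale0r subr0.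
rewrite bilinear_Pp_conj mul1r mul0r subr0.
have deltaE (F : nat -> {poly R}) :
    \sum_(k < dimW M) (delta_mx i 0 : 'cV_(dimW M)) k 0 *: F k = F i.
  rewrite (bigD1 i) //= !mxE !eqxx scale1r big1 ?addr0 // => k ki.
  by rewrite mxE (negPf ki) scale0r.
rewrite {1}/field0 (deltaE (fun k => comp0 (interlaced k))).
rewrite {1}/field1 (deltaE (fun k => comp1 (interlaced k))).
have [-> ->] := col_fields j2.
have [j4|j4] := ltnP 4 j.
  have -> : entry_field0 j = comp0 (interlaced j).
    by move: j4; case: (nat_of_ord j) => [|[|[|[|[|]]]]].
  have -> : entry_field1 j = comp1 (interlaced j).
    by move: j4; case: (nat_of_ord j) => [|[|[|[|[|]]]]].
  exact: high_moments_orthogonal.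
have at0 l k n : (l < 2)%N -> (k.+1 < n)%N ->
    Lam l ('X * P l k * - \sum_(m < n) (P l m).[0] *: P l m) = 0.
  move=> l2 kn; rewrite mulrN linearN /= reproducing_at0 //.
    by rewrite hornerM hornerX mul0r oppr0.
  by rewrite mulrC size_mulX ?size_orthopoly ?orthopoly_neq0.
rewrite /energy_form; have [j3|j3] : nat_of_ord j = 3 \/ nat_of_ord j = 4 by lia.
  rewrite j3 /entry_field1 /entry_field0 mulr0 linear0 addr0.
  case: (nat_of_ord i) i3 => [|[|[|//]]] _; rewrite /comp0 /interlaced /= ?at0 //.
  by rewrite mulr0 mul0r linear0.
rewrite j3 /entry_field1 /entry_field0 mulr0 linear0 add0r.
by case: (nat_of_ord i) i3 => [|[|[|//]]] _;
  rewrite /comp1 /interlaced /= ?at0 // mulr0 mul0r linear0.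
Qed.

(** By the matching conditions [D^T A D] has no entry that couples an
    equilibrium unknown to a relaxing one. *)
Lemma relaxation_symmetric (A : 'M[R]_(dimW M)) :
  A = Pp_mx M *m A0_mx M zeta *m (Pp_mx M)^T ->
  D^T *m A *m D *m relaxing = relaxing^T *m (D^T *m A *m D *m relaxing).
Proof.
move=> AE; set G := D^T *m A *m D.
have mulE (B : 'M[R]_(dimW M)) i j : (B *m relaxing) i j
  = if (2 < j)%N then B i j else 0.
  rewrite mxE (bigD1 j) //= mxE eqxx big1 ?addr0 => [|k /negPf kj].
    by case: ltnP; rewrite ?mulr1 ?mulr0.
  by rewrite mxE kj mulr0.
apply/matrixP => i j.
rewrite -{1}[relaxing]trmxK -[X in relaxing^T *m X]trmxK -trmx_mul [RHS]mxE mulE [X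
  in if _ then X else _]mxE.
rewrite trmxK !mulE; case: ltnP => // j2; case: ltnP => // i3.
rewrite /G -mulmxA mxE big1 // => k _; rewrite mxE.
have [k3|k3] := ltnP k 3; first by rewrite AE Landau_orthogonality // mulr0.
rewrite DE /equilibrium_entry; move: k3 i3.
case: (nat_of_ord k) => [|[|[|[|[|m]]]]] //;
  by case: (nat_of_ord i) => [|[|[|]]] //= _ _; rewrite mul0r.
Qed.

End EquilibriumMatrix.

Lemma Pp_lin_sym M c d (K := Pp_mx M *m (c *: A0_mx M zeta - d *: A1_mx M zeta)
    *m (Pp_mx M)^T) : K^T = K.
Proof.
apply/matrixP => i j; rewrite mxE !Pp_lin_conj.
have symE f g h k : energy_form f g h k = energy_form h k f g.
  by rewrite /energy_form mulrAC [X in _ + Lam 1 X]mulrAC.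
have symF f g h k : flux_form f g h k = flux_form h k f g.
  by rewrite /flux_form addrC [f * k]mulrC [g * h]mulrC.
by rewrite symE symF.
Qed.

Lemma dispersion_equilibrium M (tau u theta a b c : R) (W : 'cV[R]_(dimW M))
    (omega k : R[i]) :
  (0 < M)%N -> 0 < tau -> `|u| < 1 -> theta^-1 = zeta ->
  velocity W = u -> temperature W = theta -> a != 0 -> c != 0 ->
  (forall i j, D_mx W i j = equilibrium_entry a b c i j) ->
  dispersion tau W omega k = 0 ->
  exists m x r : R, [/\ 0 < m, 0 <= r
    & 'i%C * omega * m%:C%C - 'i%C * k * x%:C%C + r%:C%C = 0].
Proof.
move=> M0 tau0 u1 thetaE uE tE a0 c0 DE.
pose A := Pp_mx M *m A0_mx M zeta *m (Pp_mx M)^T.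
have AE : A = Pp_mx M *m (1 *: A0_mx M zeta - 0 *: A1_mx M zeta) *m (Pp_mx M)^T.
  by rewrite scale1r scale0r subr0.
have symA : A^T = A by rewrite AE Pp_lin_sym.
have DWtE : DWt_mx M theta = D_mx W *m relaxing M.
  apply/matrixP => i j; rewrite [RHS]mxE (bigD1 j) //= big1 ?addr0; last first.
    by move=> l /negPf lj; rewrite [X in _ * X]mxE lj mulr0.
  rewrite [X in _ * X]mxE eqxx DE !mxE thetaE.
  case: (nat_of_ord j) => [|[|[|j']]]; rewrite ?mulr1 ?mulr0.
  - by case: (nat_of_ord i) => [|[|[|[|[|i']]]]].
  - by case: (nat_of_ord i) => [|[|[|[|[|i']]]]].
  - by case: (nat_of_ord i) => [|[|[|[|[|i']]]]].
  - by rewrite andbF.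
have QE : Q_mx tau W = - tau^-1 *: (A *m D_mx W *m relaxing M).
  rewrite /Q_mx uE tE DWtE mulmxA /Mt_mx /Mx_mx thetaE; congr (_ *: (_ *m _ *m _)).
  have conj_lin (s t : R) (X Y : 'M[R]_(dimW M)) :
      s *: (Pp_mx M *m X *m (Pp_mx M)^T) - t *: (Pp_mx M *m Y *m (Pp_mx M)^T) =
      Pp_mx M *m (s *: X - t *: Y) *m (Pp_mx M)^T.
    by rewrite mulmxBr mulmxBl -!scalemxAr -!scalemxAl.
  rewrite conj_lin /A; congr (_ *m _ *m _); apply/matrixP => i j.
  have lin (s t : R) (X Y : 'M[R]_(dimW M)) :
      (s *: X - t *: Y) i j = s * X i j - t * Y i j by rewrite !mxE.
  rewrite !lin.
  transitivity ((U0 u ^+ 2 - U1 u ^+ 2) * A0_mx M zeta i j); first by ring.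
  by rewrite gamma_sqr // mul1r.
rewrite /dispersion QE /B0_mx /B1_mx uE tE scaleNr map_mxN opprK.
apply: dispersion_scalar.
- by rewrite /Mt_mx thetaE Pp_lin_sym.
- by rewrite /Mx_mx thetaE Pp_lin_sym.
- exact: symA.
- move=> v v0; rewrite /quad /Mt_mx thetaE bilinear_Pp_conj.
  rewrite /U1 -mulrA -(mulrCA (U0 u)) -mulrBr mulr_gt0 ?gamma_gt0 //.
  apply: time_form_gt0 => //; rewrite -negb_and; apply: contra_neqN v0.
  by move=> /andP[/eqP f0 /eqP g0]; exact: field_eq0.
- by move=> v; rewrite /quad AE bilinear_Pp_conj mul1r mul0r subr0 energy_form_ge0.
- exact: (equilibrium_det DE).
- exact: (relaxation_symmetric DE).
- by rewrite invr_ge0 ltW.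
Qed.

End MomentAlgebra.

Local Open Scope classical_set_scope.

(** * Hyperbolic functions and increasing substitutions *)

Definition sinh {R : realType} (x : R) : R := (expR x - expR (- x)) / 2.

Section HyperbolicFunctions.
Variable R : realType.
Implicit Types x t : R.

Lemma is_derive_expRN x : is_derive x 1 (fun y : R => expR (- y)) (- expR (- x)).
Proof.
have dN : is_derive x 1 (fun y : R => - y) (- 1) by exact: is_deriveNid.
have := @is_derive1_comp R expR (fun y => - y) x _ _ (is_derive_expR (- x)) dN.
by rewrite mulrN1.
Qed.

Global Instance is_derive_cosh x : is_derive x 1 cosh (sinh x).
Proof.
have dN := is_derive_expRN x.
rewrite /cosh /sinh.
have -> : (fun x : R => (expR x + expR (- x)) / 2)
        = (2^-1 : R) \*: (expR + (fun y : R => expR (- y))).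
  by apply/funext => y; rewrite fctE mulrC.
by apply: is_derive_eq; rewrite mulrC.
Qed.

Global Instance is_derive_sinh x : is_derive x 1 sinh (cosh x).
Proof.
have dN := is_derive_expRN x.
rewrite /cosh /sinh.
have -> : (fun x : R => (expR x - expR (- x)) / 2)
        = (2^-1 : R) \*: (expR - (fun y : R => expR (- y))).
  by apply/funext => y; rewrite fctE mulrC.
by apply: is_derive_eq; rewrite opprK mulrC.
Qed.

Lemma is_derive_continuous (f : R -> R) x d : is_derive x 1 f d ->
  {for x, continuous f}.
Proof.
by move=> df; apply/differentiable_continuous/derivable1_diffP; exact: ex_derive.
Qed.

Lemma continuous_cosh : continuous (@cosh R).
Proof. by move=> x; apply: is_derive_continuous. Qed.

Lemma continuous_sinh : continuous (@sinh R).
Proof. by move=> x; apply: is_derive_continuous. Qed.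

Lemma cosh_sqr x : cosh x ^+ 2 - sinh x ^+ 2 = 1.
Proof.
have := expRxMexpNx_1 x; rewrite /cosh /sinh.
move: (expR x) (expR (- x)) => a b ab; rewrite -[RHS]ab.
by field; rewrite ?pnatr_eq0.
Qed.

Lemma coshN x : cosh (- x) = cosh x.
Proof. by rewrite /cosh opprK addrC. Qed.

Lemma sinhN x : sinh (- x) = - sinh x.
Proof. by rewrite /sinh opprK -mulNr opprB. Qed.

Lemma sinh_gt0 x : 0 < x -> 0 < sinh x.
Proof.
move=> x0; rewrite /sinh divr_gt0 // subr_gt0 ltr_expR.
by rewrite (lt_trans _ x0) // oppr_lt0.
Qed.

Lemma cosh_ge1 x : 1 <= cosh x.
Proof.
have c0 : 0 < cosh x by rewrite /cosh divr_gt0 // addr_gt0 ?expR_gt0.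
by have := cosh_sqr x; have := sqr_ge0 (sinh x); nra.
Qed.

Lemma cosh_gt0 x : 0 < cosh x.
Proof. exact: lt_le_trans (cosh_ge1 x). Qed.

Lemma cosh_ge_expR x : expR x / 2 <= cosh x.
Proof. by rewrite /cosh ler_pM2r ?invr_gt0 // lerDl expR_ge0. Qed.

Lemma cosh_lt : {in `[0, +oo[%R &, {homo (@cosh R) : x y / x < y}}.
Proof.
move=> x y; rewrite !in_itv /= !andbT => x0 y0 xy.
apply: (@gtr0_derive1_incr _ cosh x y) => //.
- by move=> z zxy; rewrite derive1E derive_val sinh_gt0 // (le_lt_trans x0) // (itvP
  zxy).
- exact/continuous_subspaceT/continuous_cosh.
Qed.

End HyperbolicFunctions.

Section Substitution.
Variable R : realType.
Local Notation mu := (@lebesgue_measure R).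

(** The endpoints [a n], [b n] stay inside the interval of integration, so that
    neither the convergence of the derivative at its ends nor the continuity
    of the integrand there is needed: this covers a singular density and a
    derivative growing to infinity. *)
Lemma substitution_increasing (F f G : R -> R) (a b : nat -> R) :
  (forall x : R, is_derive x 1 F (f x)) -> continuous f ->
  (forall n, a n < b n) ->
  nonincreasing_seq a -> nondecreasing_seq b ->
  (forall n x, a n <= x <= b n -> 0 < f x) ->
  (forall n x, F (a n) <= x <= F (b n) -> {for x, continuous G}) ->
  (\int[mu]_(x in \bigcup_n `[F (a n), F (b n)]) (G x)%:E =
   \int[mu]_(x in \bigcup_n `[a n, b n]) (G (F x) * f x)%:E)%E.
Proof.
move=> dF cf ab aN bN fpos.
have cF : continuous F by move=> x; apply: is_derive_continuous.
have F1 : F^`() = f by apply/funext => x; rewrite derive1E derive_val.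
have incr n : {in `[a n, b n]%R &, {homo F : x y / x < y}}.
  move=> x y; rewrite !in_itv /= => /andP[ax _] /andP[_ yb] xy.
  apply: (@gtr0_derive1_incr _ F (a n) (b n)) => //.
  - move=> z; rewrite in_itv /= => /andP[/ltW az /ltW zb].
    by rewrite F1 (fpos n) // az zb.
  - exact: continuous_subspaceT.
have le_F n x y : a n <= x -> x <= y -> y <= b n -> F x <= F y.
  move=> ax; rewrite le_eqVlt => /predU1P[->//|xy] yb; apply/ltW/(incr n) => //.
    by rewrite in_itv /= ax (le_trans (ltW xy)).
  by rewrite in_itv /= yb (le_trans ax (ltW xy)).
wlog G0 : G / forall x, 0 <= G x => [ge0_case|] cG.
  have fE x : (\bigcup_n `[a n, b n]) x -> 0 <= f x.
    by move=> [n _]; rewrite /= in_itv /= => /fpos/ltW.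
  have pos_part (s : R) :
    (\int[mu]_(x in \bigcup_n `[F (a n), F (b n)]) (maxe (s * G x)%:E 0) =
     \int[mu]_(x in \bigcup_n `[a n, b n]) (maxe (s * (G (F x) * f x))%:E 0))%E.
    have max_ge0 x : 0 <= Num.max (s * G x) 0 by rewrite le_max lexx orbT.
    have cmax n x : F (a n) <= x <= F (b n) ->
        {for x, continuous (fun x => Num.max (s * G x) 0)}.
      move=> /cG cGx; apply: (@continuous_max _ _ (fun x => s * G x) (cst 0)).
        by apply: continuousM => //; exact: cst_continuous.
      exact: cst_continuous.
    under eq_integral do rewrite -EFin_max.
    rewrite (ge0_case _ max_ge0 cmax).
    apply: eq_integral => x; rewrite inE => /fE fx.
    by rewrite -EFin_max mulrA; congr EFin; rewrite -[in RHS](mul0r (f x)) maxr_pMl.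
  rewrite [LHS]integralE [RHS]integralE; congr (_ - _)%E.
    transitivity (\int[mu]_(x in \bigcup_n `[F (a n),
      F (b n)]) (maxe (1 * G x)%:E 0))%E.
      by apply: eq_integral => x _; rewrite mul1r funeposE.
    by rewrite pos_part; apply: eq_integral => x _; rewrite mul1r funeposE.
  transitivity (\int[mu]_(x in \bigcup_n `[F (a n), F (b n)]) (maxe (-1 * G x)%:E 0))%E.
    by apply: eq_integral => x _; rewrite mulN1r EFinN funenegE.
  by rewrite pos_part; apply: eq_integral => x _; rewrite mulN1r EFinN funenegE.
have key n : (\int[mu]_(x in `[F (a n), F (b n)]) (G x)%:E =
              \int[mu]_(x in `[a n, b n]) (G (F x) * f x)%:E)%E.
  rewrite (@integration_by_substitution_increasing _ F) ?F1 //.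
  - exact/ltW.
  - by apply/cvg_ex; exists (f (a n)); apply: cvg_at_right_filter; exact: cf.
  - by apply/cvg_ex; exists (f (b n)); apply: cvg_at_left_filter; exact: cf.
  - split=> [x _|//|//]; first exact: ex_derive.
      by apply: cvg_at_right_filter; exact: cF.
    by apply: cvg_at_left_filter; exact: cF.
  - apply: continuous_in_subspaceT => x; rewrite inE /= in_itv /=; exact: cG.
have nd (g h : nat -> R) : nonincreasing_seq g -> nondecreasing_seq h ->
    nondecreasing_seq (fun n => `[g n, h n] : set R).
  move=> gN hN m n mn; apply/subsetPset; apply: subset_itv; rewrite bnd_simp.
    exact: gN.
  exact: hN.
have FaN : nonincreasing_seq (F \o a).
  move=> m n mn; apply: (le_F n) => //; first exact: aN.
  exact: le_trans (ltW (ab m)) (bN _ _ mn).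
have FbN : nondecreasing_seq (F \o b).
  move=> m n mn; apply: (le_F n) => //; last exact: bN.
  exact: le_trans (aN _ _ mn) (ltW (ab m)).
have lhs := @ge0_nondecreasing_set_cvg_integral _ (measurableTypeR R) R
  (fun n => `[F (a n), F (b n)]) (fun x => (G x)%:E) mu (nd _ _ FaN FbN)
  (fun n => measurable_itv _).
have rhs := @ge0_nondecreasing_set_cvg_integral _ (measurableTypeR R) R
  (fun n => `[a n, b n]) (fun x => (G (F x) * f x)%:E) mu (nd _ _ aN bN)
  (fun n => measurable_itv _).
have cGin n : {within `[F (a n), F (b n)], continuous G}.
  by apply: continuous_in_subspaceT => x; rewrite inE /= in_itv /=; exact: cG.
have {}lhs : (\int[mu]_(x in `[F (a i), F (b i)]) (G x)%:E @[i --> \oo] -->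
    \int[mu]_(x in \bigcup_i `[F (a i), F (b i)]) (G x)%:E)%E.
  apply: lhs => [n|n x _]; last by rewrite lee_fin.
  by apply/measurable_EFinP; apply: subspace_continuous_measurable_fun.
have {}rhs : (\int[mu]_(x in `[a i, b i]) (G (F x) * f x)%:E @[i --> \oo] -->
    \int[mu]_(x in \bigcup_i `[a i, b i]) (G (F x) * f x)%:E)%E.
  apply: rhs => [n|n x]; last first.
    rewrite /= in_itv /= => xab; rewrite lee_fin mulr_ge0 // ltW //.
    exact: (fpos n).
  apply/measurable_EFinP; apply: subspace_continuous_measurable_fun => //.
  apply: continuous_in_subspaceT => x; rewrite inE /= in_itv /= => /andP[ax xb].
  apply: continuousM; last exact: cf.
  apply: continuous_comp; first exact: cF.
  by apply: (cG n); rewrite !(le_F n) // (le_trans ax).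
rewrite -(cvg_lim _ lhs) // -(cvg_lim _ rhs) //.
by congr (lim _); under eq_fun do rewrite key.
Qed.

End Substitution.

(** * The weights in the variable arcosh x *)

Section LaplaceTransform.
Variable R : realType.
Local Notation mu := (@lebesgue_measure R).
Implicit Types (zeta t : R) (q : {poly R}).

Definition boltzmann zeta q t : R := q.[cosh t] * expR (- (zeta * cosh t)).

Lemma continuous_boltzmann zeta q : continuous (boltzmann zeta q).
Proof.
move=> t; apply: (@continuousM _ _ (fun t => q.[cosh t])
  (fun t => expR (- (zeta * cosh t)))).
  apply: (@continuous_comp _ _ _ (@cosh R) (fun x => q.[x])).
    exact: continuous_cosh.
  exact: continuous_horner.
apply: (@continuous_comp _ _ _ (fun t => - (zeta * cosh t)) expR).
  apply: continuousN; apply: continuousM; first exact: cst_continuous.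
  exact: continuous_cosh.
exact: continuous_expR.
Qed.

Lemma exp_bound n zeta (y : R) : 0 < zeta -> 0 <= y ->
  y ^+ n.+1 * expR (- (zeta * y)) <= (n.+1%:R / zeta) ^+ n.+1.
Proof.
move=> z0 y0; rewrite expRN ler_pdivrMr ?expR_gt0 //.
have -> : zeta * y = n.+1%:R * (zeta * y / n.+1%:R).
  by rewrite [RHS]mulrC divfK // pnatr_eq0.
rewrite expRM_natl -exprMn lerXn2r ?nnegrE //.
  by rewrite mulr_ge0 ?expR_ge0 // divr_ge0 ?ler0n // ltW.
have n0 : n.+1%:R != 0 :> R by rewrite pnatr_eq0.
have yE (m : R) : m != 0 -> y = m / zeta * (zeta * y / m).
  by move=> m0; field; rewrite m0 gt_eqF.
rewrite {1}(yE _ n0) ler_wpM2l ?divr_ge0 ?ler0n ?(ltW z0) //.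
by rewrite (le_trans _ (expR_ge1Dx _)) // lerDr.
Qed.

Lemma horner_bound q : exists2 C : R, 0 <= C &
  forall y : R, 1 <= y -> `|q.[y]| <= C * y ^+ size q.
Proof.
exists (\sum_(i < size q) `|q`_i|); first by rewrite sumr_ge0.
move=> y y1; rewrite horner_coef mulr_suml (le_trans (ler_norm_sum _ _ _)) //.
apply: ler_sum => i _; rewrite normrM ler_wpM2l // normrX ger0_norm.
  by rewrite ler_weXn2l // ltnW.
exact: le_trans y1.
Qed.

(** One more power of [cosh t] than needed is absorbed by the exponential; it
    leaves the integrable factor [1 / cosh t <= 2 exp (- t)]. *)
Lemma boltzmann_bound zeta q : 0 < zeta -> exists2 C : R, 0 <= C &
  forall t, `|boltzmann zeta q t| <= C * expR (- t).
Proof.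
move=> z0; have [C C0 qC] := horner_bound q; set n := size q in qC.
exists (C * (n.+1%:R / zeta) ^+ n.+1 * 2).
  by rewrite !mulr_ge0 // exprn_ge0 // divr_ge0 ?ler0n // ltW.
move=> t; rewrite /boltzmann normrM (ger0_norm (expR_ge0 _)).
have c0 := cosh_gt0 t.
apply: (@le_trans _ _ (C * (n.+1%:R / zeta) ^+ n.+1 / cosh t)).
  rewrite ler_pdivlMr //.
  apply: (@le_trans _ _ (C * cosh t ^+ n * expR (- (zeta * cosh t)) * cosh t)).
    by rewrite !ler_wpM2r ?expR_ge0 ?qC ?cosh_ge1 // ltW.
  have -> : C * cosh t ^+ n * expR (- (zeta * cosh t)) * cosh t =
            C * (cosh t ^+ n.+1 * expR (- (zeta * cosh t))) by rewrite exprSr; ring.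
  by rewrite ler_wpM2l // exp_bound // ltW.
rewrite -[leRHS]mulrA ler_wpM2l //.
  by rewrite mulr_ge0 // exprn_ge0 // divr_ge0 ?ler0n // ltW.
rewrite -[leLHS]mul1r ler_pdivrMr // expRN mulrAC ler_pdivlMr ?expR_gt0 // mul1r.
by have := cosh_ge_expR t; lra.
Qed.

Lemma integrable_expRN : mu.-integrable `[0%R, +oo[ (EFin \o (fun t => expR (- t))).
Proof.
have int1 : mu.-integrable `[0%R, +oo[ (EFin \o exponential_pdf (1 : R)).
  apply: (@integrableS _ _ _ _ setT) => //.
  exact: integrable_exponential_pdf.
apply: eq_integrable int1 => // t; rewrite inE /= in_itv /= andbT => t0.
by rewrite exponential_pdfE //= mul1r mulN1r.
Qed.

Lemma integrable_bounded_expRN (f : R -> R) (C : R) : continuous f ->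
  (forall t, `|f t| <= C * expR (- t)) -> mu.-integrable `[0%R, +oo[ (EFin \o f).
Proof.
move=> cf fC.
have intC : mu.-integrable `[0%R, +oo[ (fun t => C%:E * (expR (- t))%:E)%E.
  by apply: integrableZl => //; exact: integrable_expRN.
apply: le_integrable intC => //.
  by apply/measurable_EFinP/measurable_funTS; exact: continuous_measurable_fun.
by move=> t _ /=; rewrite lee_fin (le_trans (fC t)) // ler_norm.
Qed.

Lemma integrable_boltzmann zeta q : 0 < zeta ->
  mu.-integrable `[0%R, +oo[ (EFin \o boltzmann zeta q).
Proof.
move=> z0; have [C _ bound] := boltzmann_bound q z0.
exact: integrable_bounded_expRN (@continuous_boltzmann _ _) bound.
Qed.

Lemma norm_sinh_le t : `|sinh t| <= cosh t.
Proof.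
rewrite ler_norml /cosh /sinh -mulNr !ler_pM2r ?invr_gt0 //.
by have := expR_gt0 t; have := expR_gt0 (- t); lra.
Qed.

Lemma integrable_boltzmann_sinh zeta q : 0 < zeta ->
  mu.-integrable `[0%R, +oo[ (EFin \o (fun t => boltzmann zeta q t * sinh t)).
Proof.
move=> z0; have [C _ bound] := boltzmann_bound (q * 'X) z0.
apply: (@integrable_bounded_expRN _ C).
  move=> t; apply: continuousM; first exact: continuous_boltzmann.
  exact: continuous_sinh.
move=> t; apply: le_trans (bound t).
have -> : boltzmann zeta (q * 'X) t = boltzmann zeta q t * cosh t.
  by rewrite /boltzmann hornerM hornerX mulrAC.
rewrite (normrM (boltzmann zeta q t) (sinh t)) (normrM _ (cosh t)) ler_wpM2l //.
by rewrite (ger0_norm (ltW (cosh_gt0 t))) norm_sinh_le.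
Qed.

(** Up to normalization this is integration in weight 0, and integration in
    weight 1 once the polynomial is multiplied by [X^2 - 1]. *)
Definition laplace zeta q : R := \int[mu]_(t in `[0%R, +oo[) boltzmann zeta q t.

Lemma laplace_linear zeta : 0 < zeta -> linear (laplace zeta).
Proof.
move=> z0 a p q; change (laplace zeta (a *: p + q)
  = a * laplace zeta p + laplace zeta q).
rewrite /laplace -RintegralZl //; last exact: integrable_boltzmann.
rewrite -RintegralD //; last exact: integrable_boltzmann.
  by apply: eq_Rintegral => t _; rewrite /boltzmann hornerD hornerZ; ring.
have int_p : mu.-integrable `[0%R, +oo[ (fun t => a%:E * (boltzmann zeta p t)%:E)%E.
  by apply: integrableZl => //; exact: integrable_boltzmann.
exact: int_p.
Qed.

Lemma exists_cosh_nonroot q : q != 0 -> exists2 t, 0 < t & q.[cosh t] != 0.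
Proof.
move=> q0; pose rs := [seq cosh (k%:R : R) | k <- iota 1 (size q)].
have urs : uniq rs.
  rewrite map_inj_in_uniq ?iota_uniq // => k m _ _ km.
  apply/eqP; case: (ltngtP k m) => // lt.
    by have := @cosh_lt R k%:R m%:R;
      rewrite !in_itv /= !ler0n ltr_nat km ltxx => /(_ isT isT lt).
  by have := @cosh_lt R m%:R k%:R;
    rewrite !in_itv /= !ler0n ltr_nat km ltxx => /(_ isT isT lt).
have /allPn[x /mapP[k]] : ~~ all (root q) rs.
  apply/negP => ars; have := max_poly_roots q0 ars urs.
  by rewrite size_map size_iota ltnn.
rewrite mem_iota => /andP[k1 _] -> qk; exists k%:R => //.
by rewrite ltr0n.
Qed.

(** The integrand is nonnegative and continuous, and positive at some point
    because a polynomial cannot vanish at [cosh 1, cosh 2, ...]. *)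
Lemma laplace_pos zeta : 0 < zeta -> positive_on_ray (laplace zeta).
Proof.
move=> z0 q q0 qpos.
have bpos t : 0 <= boltzmann zeta q t by rewrite mulr_ge0 ?expR_ge0 ?qpos ?cosh_ge1.
have [t1 t10 qt1] := exists_cosh_nonroot q0.
have bt1 : 0 < boltzmann zeta q t1.
  by rewrite lt0r bpos andbT mulf_neq0 // gt_eqF // expR_gt0.
(* Continuity bounds the integrand below by c on some [t1, t1 + d]. *)
pose c := boltzmann zeta q t1 / 2.
have c0 : 0 < c by rewrite divr_gt0.
have ct1 : c < boltzmann zeta q t1 by rewrite /c; lra.
have [d d0 bd] : exists2 d : R, 0 < d &
    forall t, t1 <= t <= t1 + d -> c <= boltzmann zeta q t.
  have := @continuous_boltzmann zeta q t1 => /cvgr_gt /(_ c ct1).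
  move=> /nbhs_ballP[e /= e0 be]; exists (e / 2); first by rewrite divr_gt0.
  move=> t /andP[t1t tt1]; apply/ltW/be; rewrite /ball /= ltr_norml.
  by apply/andP; split; lra.
have fin := integrable_fin_num _ (integrable_boltzmann q z0).
rewrite /laplace /Rintegral -lte_fin fineK ?fin //.
have mb (D : set R) : measurable_fun D (EFin \o boltzmann zeta q).
  apply/measurable_EFinP/measurable_funTS => //.
  apply: continuous_measurable_fun; exact: continuous_boltzmann.
have low : (0%:E < \int[mu]_(t in `[t1, (t1 + d)%R]) c%:E)%E.
  rewrite integral_cst //= lebesgue_measure_itv /= lte_fin ltrDl d0 -EFinD -EFinM
    lte_fin.
  by rewrite mulr_gt0 //; lra.
apply: (lt_le_trans low).
have mid : (\int[mu]_(t in `[t1, (t1 + d)%R]) c%:E <=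
    \int[mu]_(t in `[t1, (t1 + d)%R]) (boltzmann zeta q t)%:E)%E.
  apply: ge0_le_integral => //.
  - by move=> t _; rewrite lee_fin ltW.
  - exact: mb.
apply: le_trans mid _; apply: ge0_subset_integral => //.
- exact: mb.
- by move=> t _; rewrite lee_fin.
- by move=> t /=; rewrite !in_itv /= andbT => /andP[t1t _];
  rewrite (le_trans (ltW t10)).
Qed.

Lemma besselK1E zeta : besselK 1 zeta = laplace zeta 'X.
Proof.
by apply: eq_Rintegral => t _; rewrite mul1r /boltzmann hornerX.
Qed.

Lemma besselK1_gt0 zeta : 0 < zeta -> 0 < besselK 1 zeta.
Proof.
move=> z0; rewrite besselK1E; apply: laplace_pos => //; first by rewrite polyX_eq0.
by move=> x x1; rewrite hornerX (le_trans ler01).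
Qed.

Lemma lnK_gt0 (x : R) : 0 < x -> expR (ln x) = x.
Proof. by move=> x0; rewrite lnK // posrE. Qed.

Lemma cosh_preimage (x : R) : 1 < x -> exists2 t, 0 < t & cosh t = x.
Proof.
move=> x1; pose s := Num.sqrt (x ^+ 2 - 1).
have x21 : 0 < x ^+ 2 - 1 by nra.
have s2 : s ^+ 2 = x ^+ 2 - 1 by rewrite sqr_sqrtr // ltW.
have s0 : 0 < s by rewrite sqrtr_gt0.
have xs : 0 < x + s by lra.
exists (ln (x + s)); first by rewrite ln_gt0 //; lra.
rewrite /cosh expRN lnK_gt0 //.
have -> : (x + s)^-1 = x - s.
  by apply: (mulfI (lt0r_neq0 xs)); rewrite mulfV ?lt0r_neq0 //; nra.
by lra.
Qed.

(** An open half line is exhausted by images of the compact intervals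
    [[1 / (n + 1), n + 2]]; these avoid the left end, where the weight of
    index 0 is singular. *)
Lemma bigcup_itv_oy (F : R -> R) (l : R) : {in `]0, +oo[%R &, {homo F : x y / x < y}} ->
  (forall t, 0 < t -> l < F t) -> (forall x, l < x -> exists2 t, 0 < t & F t = x) ->
  \bigcup_n `[F n.+1%:R^-1, F n.+2%:R] = `]l, +oo[.
Proof.
move=> incF lF surF; apply/seteqP; split=> x.
  move=> [n _] /=; rewrite !in_itv /= andbT => /andP[+ _]; apply: lt_le_trans.
  by apply: lF; rewrite invr_gt0 ltr0n.
rewrite /= in_itv /= andbT => /surF[t t0 <-].
have leF y z : 0 < y -> y <= z -> F y <= F z.
  move=> y0; rewrite le_eqVlt => /predU1P[->//|yz]; apply/ltW/incF => //.
    by rewrite in_itv /= y0.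
  by rewrite in_itv /= (lt_trans y0).
pose n := Num.truncn (Num.max t t^-1).
have nt : Num.max t t^-1 < n.+1%:R.
  by rewrite truncnS_gt.
move: nt; rewrite gt_max => /andP[tn tVn].
exists n => //=; rewrite in_itv /= !leF // ?invr_gt0 ?ltr0n //.
  by rewrite (le_trans (ltW tn)) // ler_nat.
by rewrite -[leRHS]invrK lef_pV2 ?posrE ?invr_gt0 ?ltr0n // ltW.
Qed.

Lemma continuous_weight l zeta (x : R) : 1 < x -> {for x, continuous (weight l zeta)}.
Proof.
move=> x1; suff : weight l zeta y @[y --> x] --> weight l zeta x by [].
have x21 : 0 < x ^+ 2 - 1 by nra.
apply: cvgM.
  apply: cvgM; first exact: cvg_cst.
  apply: (@cvg_comp _ _ _ (fun y : R => y ^+ 2 - 1) (@powR R ^~ (l%:R - 2^-1))).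
    by apply: cvgB; [exact: exprn_continuous|exact: cvg_cst].
  exact: (is_derive_continuous (is_derive1_powR (l%:R - 2^-1) x21)).
apply: (@cvg_comp _ _ _ (fun y : R => - (zeta * y)) expR); last exact: continuous_expR.
by apply: cvgN; apply: cvgM; [exact: cvg_cst|exact: cvg_id].
Qed.

Lemma weight_cosh l zeta t : (l < 2)%N -> 0 < t ->
  weight l zeta (cosh t) * sinh t =
  (besselK 1 zeta)^-1 * (cosh t ^+ 2 - 1) ^+ l * expR (- (zeta * cosh t)).
Proof.
move=> l2 t0; rewrite /weight mulrAC; congr (_ * _); rewrite -mulrA; congr (_ * _).
have s0 := sinh_gt0 t0.
have -> : cosh t ^+ 2 - 1 = sinh t ^+ 2 by have := cosh_sqr t; lra.
have sq : (sinh t ^+ 2) `^ (2^-1) = sinh t.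
  by rewrite powR12_sqrt ?sqr_ge0 // sqrtr_sqr gtr0_norm.
case: l l2 => [|[|//]] _.
  by rewrite sub0r powRN sq mulVf // gt_eqF.
have -> : 1%:R - 2^-1 = 2^-1 :> R by lra.
by rewrite sq expr1 expr2.
Qed.

(** With [x = cosh t] the measure [(x^2 - 1)^(l - 1/2) dx] becomes
    [(sinh t)^(2 l) dt]. *)
Lemma weight_ipE l zeta f g : (l < 2)%N -> 0 < zeta ->
  weight_ip l zeta f g = (besselK 1 zeta)^-1 * laplace zeta (f * g * ('X^2 - 1) ^+ l).
Proof.
move=> l2 z0; rewrite /laplace -RintegralZl //; last exact: integrable_boltzmann.
rewrite /weight_ip /Rintegral; congr fine.
pose G x := f.[x] * g.[x] * weight l zeta x.
have cG (x : R) : 1 < x -> {for x, continuous G}.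
  move=> x1; apply: (@continuousM _ _ (fun x => f.[x] * g.[x]) (weight l zeta)).
    by apply: continuousM; exact: continuous_horner.
  exact: continuous_weight.
pose H t := (besselK 1 zeta)^-1 * boltzmann zeta (f * g * ('X^2 - 1) ^+ l) t.
have cH : continuous H.
  move=> t; apply: (@continuousM _ _ (cst (besselK 1 zeta)^-1)).
    exact: cst_continuous.
  exact: continuous_boltzmann.
rewrite -integral_itv_obnd_cbnd; last first.
  apply/measurable_EFinP; apply: open_continuous_measurable_fun => //.
  by move=> x; rewrite inE /= in_itv /= andbT; exact: cG.
rewrite -[RHS]integral_itv_obnd_cbnd; last first.
  by apply/measurable_EFinP/measurable_funTS => //; exact: continuous_measurable_fun.
have cosh_gt1 t : 0 < t -> 1 < cosh t.
  by move=> t0; have := cosh_sqr t; have := sinh_gt0 t0; have := cosh_ge1 t; nra.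
have incr : {in `]0, +oo[%R &, {homo (@cosh R) : x y / x < y}}.
  move=> x y; rewrite !in_itv /= !andbT => /ltW x0 /ltW y0.
  by apply: cosh_lt; rewrite in_itv /= ?x0 ?y0.
rewrite -(bigcup_itv_oy incr cosh_gt1 cosh_preimage).
rewrite -(@bigcup_itv_oy id 0) //; last by move=> x x0; exists x.
have aN : nonincreasing_seq (fun n => n.+1%:R^-1 : R).
  by move=> m n mn; rewrite lef_pV2 ?posrE ?ltr0n // ler_nat.
have bN : nondecreasing_seq (fun n => n.+2%:R : R).
  by move=> m n mn; rewrite ler_nat.
have ab n : n.+1%:R^-1 < n.+2%:R :> R.
  rewrite (@le_lt_trans _ _ 1) ?ltr1n // invf_le1 ?ltr0n // ler1n //.
rewrite (substitution_increasing (@is_derive_cosh R) (@continuous_sinh R) ab aN bN);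
  first last.
- move=> n x /andP[nx _]; apply: cG; apply: lt_le_trans nx.
  by apply: cosh_gt1; rewrite invr_gt0 ltr0n.
- by move=> n x /andP[nx _]; apply: sinh_gt0;
  rewrite (lt_le_trans _ nx) // invr_gt0 ltr0n.
apply: eq_integral => t; rewrite inE => -[n _] /=; rewrite in_itv /= => /andP[nt _].
have t0 : 0 < t by rewrite (lt_le_trans _ nt) // invr_gt0 ltr0n.
have -> : G (cosh t) * sinh t
  = f.[cosh t] * g.[cosh t] * (weight l zeta (cosh t) * sinh t).
  by rewrite /G [RHS]mulrA.
have -> : boltzmann zeta (f * g * ('X^2 - 1) ^+ l) t =
    f.[cosh t] * g.[cosh t] * (cosh t ^+ 2 - 1) ^+ l * expR (- (zeta * cosh t)).
  by rewrite /boltzmann !hornerM horner_exp !hornerE.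
rewrite weight_cosh //; move: (_ ^+ l) => w; congr EFin; ring.
Qed.

End LaplaceTransform.

(** * The inner product in momentum space *)

Section KineticInnerProduct.
Variable R : realType.
Local Notation mu := (@lebesgue_measure R).

(** The integrand may change sign and be nonintegrable, so its positive and
    negative parts are treated separately. *)
Lemma integral_negate (G : R -> R) : continuous G ->
  (\int[mu]_(x in `]-oo, 0%R]) (G x)%:E = \int[mu]_(x in `[0%R, +oo[) (G (- x))%:E)%E.
Proof.
move=> cG.
have part (s : R) : (\int[mu]_(x in `]-oo, 0%R]) (maxe (s * G x)%:E 0) =
   \int[mu]_(x in `[0%R, +oo[) (maxe (s * G (- x))%:E 0))%E.
  have := @ge0_integration_by_substitutionNy R (fun x => Num.max (s * G x) 0) 0.
  rewrite oppr0; under eq_integral do rewrite EFin_max.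
  move=> -> //.
  - by apply: eq_integral => x _; rewrite /= EFin_max.
  - apply: continuous_subspaceT => x.
    apply: (@continuous_max _ _ (fun x => s * G x) (cst 0)).
      by apply: continuousM; [exact: cst_continuous|exact: cG].
    exact: cst_continuous.
  - by move=> x _; rewrite le_max lexx orbT.
rewrite [LHS]integralE [RHS]integralE; congr (_ - _)%E.
  transitivity (\int[mu]_(x in `]-oo, 0%R]) (maxe (1 * G x)%:E 0))%E.
    by apply: eq_integral => x _; rewrite mul1r funeposE.
  by rewrite part; apply: eq_integral => x _; rewrite mul1r funeposE.
transitivity (\int[mu]_(x in `]-oo, 0%R]) (maxe (-1 * G x)%:E 0))%E.
  by apply: eq_integral => x _; rewrite mulN1r EFinN funenegE.
by rewrite part; apply: eq_integral => x _; rewrite mulN1r EFinN funenegE.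
Qed.

(** Folding the line at 0 is what removes integrands that are odd in the
    rapidity. *)
Lemma Rintegral_fold (phi : R -> R) : continuous phi ->
  mu.-integrable `[0%R, +oo[ (EFin \o phi) ->
  mu.-integrable `[0%R, +oo[ (EFin \o (phi \o -%R)) ->
  \int[mu]_t phi t = \int[mu]_(t in `[0%R, +oo[) (phi (- t) + phi t).
Proof.
move=> cphi int1 int2; rewrite RintegralD // /Rintegral.
have mphi (D : set R) : measurable_fun D phi.
  by apply: measurable_funTS => //; exact: continuous_measurable_fun.
have -> : [set: R] = `]-oo, 0%R] `|` `]0%R, +oo[.
  by rewrite -setCitvr setvU.
rewrite integral_setU //; last first.
  apply/disj_setPRL => x /=; rewrite !in_itv /= andbT => x0; apply/negP.
  by rewrite -ltNge.
  by apply/measurable_EFinP; exact: mphi.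
rewrite integral_negate // integral_itv_obnd_cbnd; last by apply/measurable_EFinP;
  exact: mphi.
by rewrite fineD //; exact: integrable_fin_num.
Qed.

Section Boost.
Variable u : R.
Hypothesis u1 : `|u| < 1.

(** The momentum, and below it the energy, in the laboratory frame of a
    particle with rapidity [t] in the rest frame of the fluid. *)
Definition boost (t : R) : R := U1 u * cosh t + U0 u * sinh t.
Definition boost_energy (t : R) : R := U1 u * sinh t + U0 u * cosh t.

Lemma is_derive_boost (t : R) : is_derive t 1 boost (boost_energy t).
Proof.
rewrite /boost /boost_energy.
have -> : (fun t => U1 u * cosh t + U0 u * sinh t)
  = U1 u \*: cosh + U0 u \*: sinh by [].
by apply: is_derive_eq.
Qed.

Lemma continuous_boost_energy : continuous boost_energy.
Proof.
move=> t; suff : boost_energy s @[s --> t] --> boost_energy t by [].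
apply: cvgD; apply: cvgM.
- exact: cvg_cst.
- exact: continuous_sinh.
- exact: cvg_cst.
- exact: continuous_cosh.
Qed.

Let lor := gamma_sqr u1.

Lemma U0D_gt0 : 0 < U0 u + U1 u.
Proof.
have := gamma_gt0 u1; move: u1; rewrite ltr_norml /U1 => /andP[um up] g0.
by nra.
Qed.

Lemma U0B_gt0 : 0 < U0 u - U1 u.
Proof.
have := gamma_gt0 u1; move: u1; rewrite ltr_norml /U1 => /andP[um up] g0.
by nra.
Qed.

Lemma boost_energy_gt0 t : 0 < boost_energy t.
Proof.
have -> : boost_energy t = ((U0 u + U1 u) * expR t + (U0 u - U1 u) * expR (- t)) / 2.
  by rewrite /boost_energy /cosh /sinh; field.
by rewrite divr_gt0 // addr_gt0 // mulr_gt0 ?expR_gt0 ?U0D_gt0 ?U0B_gt0.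
Qed.

Lemma p0_boost t : p0 (boost t) = boost_energy t.
Proof.
rewrite /p0; have -> : 1 + boost t ^+ 2 = boost_energy t ^+ 2.
  apply/esym/eqP; rewrite -subr_eq; apply/eqP.
  transitivity ((U0 u ^+ 2 - U1 u ^+ 2) * (cosh t ^+ 2 - sinh t ^+ 2)).
    by rewrite /boost /boost_energy; ring.
  by rewrite lor cosh_sqr mulr1.
by rewrite sqrtr_sqr gtr0_norm // boost_energy_gt0.
Qed.

Lemma energy_boost t : energy u (boost t) = cosh t.
Proof.
rewrite /energy p0_boost /boost /boost_energy.
transitivity ((U0 u ^+ 2 - U1 u ^+ 2) * cosh t); first by ring.
by rewrite lor mul1r.
Qed.

Lemma p_proj_boost t : p_proj u (boost t) / U0 u = - sinh t.
Proof.
rewrite /p_proj energy_boost /boost opprD addrAC addNr add0r mulNr.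
by rewrite [U0 u * _]mulrC mulfK // gt_eqF // gamma_gt0.
Qed.

(** The sum of momentum and energy is [(U0 u + U1 u) exp t], which determines
    the rapidity. *)
Lemma boost_surj p : exists t, boost t = p.
Proof.
have p0p : p0 p ^+ 2 = 1 + p ^+ 2.
  by rewrite sqr_sqrtr // addr_ge0 // sqr_ge0.
have p0_gt : `|p| < p0 p.
  rewrite -ltr_sqr ?nnegrE ?sqrtr_ge0 // real_normK ?num_real // p0p.
  by rewrite ltrDr.
move: p0_gt; rewrite ltr_norml => /andP[pm pp].
have a0 := U0D_gt0; have b0 := U0B_gt0.
have q0 : 0 < (p + p0 p) / (U0 u + U1 u) by rewrite divr_gt0 //; lra.
exists (ln ((p + p0 p) / (U0 u + U1 u))).
have -> : forall t, boost t = ((U0 u + U1 u) * expR t - (U0 u - U1 u) * expR (- t)) / 2.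
  by move=> t; rewrite /boost /cosh /sinh; field.
rewrite expRN lnK_gt0 //.
(* Both (p0 - p) (p0 + p) and (U0 - U1) (U0 + U1) are 1. *)
have -> : ((p + p0 p) / (U0 u + U1 u))^-1 = (p0 p - p) / (U0 u - U1 u).
  apply: (mulfI (lt0r_neq0 q0)); rewrite mulfV ?lt0r_neq0 // mulf_div.
  have -> : (p + p0 p) * (p0 p - p) = p0 p ^+ 2 - p ^+ 2 by ring.
  have -> : (U0 u + U1 u) * (U0 u - U1 u) = U0 u ^+ 2 - U1 u ^+ 2 by ring.
  by rewrite p0p lor addrK divr1.
rewrite mulrCA mulfV ?lt0r_neq0 // mulrCA mulfV ?lt0r_neq0 //.
by field.
Qed.

(** The derivative of [boost] is the energy p^0, so [dp / p^0 = dt]. *)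
Lemma integral_boost (G : R -> R) : continuous G ->
  \int[mu]_p G p = \int[mu]_t (G (boost t) * boost_energy t).
Proof.
move=> cG; rewrite /Rintegral; congr fine.
have incr : {homo boost : x y / x <= y}.
  move=> x y; rewrite le_eqVlt => /predU1P[->//|xy]; apply/ltW.
  apply: (@gtr0_derive1_incr _ boost x y) => //.
  - by move=> z _; have dz := is_derive_boost z;
    rewrite derive1E derive_val boost_energy_gt0.
  - apply: continuous_subspaceT => z; exact: (is_derive_continuous (is_derive_boost z)).
have cover (t : R) : exists n, - n.+1%:R <= t <= n.+1%:R.
  exists (Num.truncn `|t|); rewrite -ler_norml; apply/ltW; exact: truncnS_gt.
have coverT : [set: R] = \bigcup_n `[(- n.+1%:R : R), n.+1%:R].
  apply/seteqP; split=> // t _.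
  by have [n ntn] := cover t; exists n => //=; rewrite in_itv.
rewrite [in RHS]coverT.
have -> : [set: R] = \bigcup_n `[boost (- n.+1%:R), boost n.+1%:R].
  apply/seteqP; split=> // p _; have [t <-] := boost_surj p.
  have [n /andP[nt tn]] := cover t; exists n => //=.
  by rewrite in_itv /= !incr.
apply: (substitution_increasing is_derive_boost continuous_boost_energy).
- by move=> n; rewrite gt0_cp // ltr0n.
- by move=> m n mn; rewrite lerN2 ler_nat.
- by move=> m n mn; rewrite ler_nat.
- by move=> n x _; exact: boost_energy_gt0.
- by move=> n x _; exact: cG.
Qed.

End Boost.

End KineticInnerProduct.

Section KineticFields.
Variable R : realType.
Local Notation mu := (@lebesgue_measure R).

Lemma continuous_p0 : continuous (@p0 R).
Proof.
move=> p; suff : p0 q @[q --> p] --> p0 p by [].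
apply: (@cvg_comp _ _ _ (fun q : R => 1 + q ^+ 2) (@Num.sqrt R)).
  by apply: cvgD; [exact: cvg_cst|exact: exprn_continuous].
exact: sqrt_continuous.
Qed.

Lemma continuous_energy (u : R) : continuous (energy u).
Proof.
move=> p; suff : energy u q @[q --> p] --> energy u p by [].
apply: cvgB; apply: cvgM;
  [exact: cvg_cst|exact: continuous_p0|exact: cvg_cst|exact: cvg_id].
Qed.

(** In the rapidity variable this is [- sinh t], whereas the energy is
    [cosh t]. *)
Definition slip (u p : R) : R := p_proj u p / U0 u.

Lemma continuous_slip (u : R) : continuous (slip u).
Proof.
move=> p; suff : slip u q @[q --> p] --> slip u p by [].
apply: cvgM; last exact: cvg_cst.
apply: cvgD; first by apply: cvgN; exact: cvg_id.
by apply: cvgM; [exact: cvg_cst|exact: continuous_energy].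
Qed.

Lemma continuous_gweight (u theta : R) : continuous (gweight u theta).
Proof.
move=> p; suff : gweight u theta q @[q --> p] --> gweight u theta p by [].
apply: cvgM; first exact: cvg_cst.
apply: (@cvg_comp _ _ _ (fun q : R => - (theta^-1 * energy u q)) expR);
  last exact: continuous_expR.
by apply: cvgN; apply: cvgM; [exact: cvg_cst|exact: continuous_energy].
Qed.

Lemma p0_gt0 (p : R) : 0 < p0 p.
Proof. by rewrite sqrtr_gt0 ltr_pwDl // sqr_ge0. Qed.

Lemma gweight_gt0 (u theta p : R) : 0 < theta -> 0 < gweight u theta p.
Proof.
move=> theta0; rewrite mulr_gt0 ?expR_gt0 // invr_gt0 mulr_gt0 //.
by rewrite besselK1_gt0 // invr_gt0.
Qed.

Definition field_value (u : R) (A B : {poly R}) (p : R) : R :=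
  A.[energy u p] + B.[energy u p] * slip u p.

Lemma continuous_field_value (u : R) A B : continuous (field_value u A B).
Proof.
move=> p; suff : field_value u A B q @[q --> p] --> field_value u A B p by [].
have chE (Q : {poly R}) : Q.[energy u q] @[q --> p] --> Q.[energy u p].
  apply: (@cvg_comp _ _ _ (energy u) (fun x => Q.[x])); first exact: continuous_energy.
  exact: continuous_horner.
apply: cvgD; first exact: chE.
by apply: cvgM; [exact: chE|exact: continuous_slip].
Qed.

(** In the rapidity variable the products [A D] and [B C] carry an odd factor
    [sinh t] and disappear, while [B D] carries [sinh^2 t = cosh^2 t - 1]. *)
Lemma kinetic_ip (u theta : R) (A B C D : {poly R}) : `|u| < 1 -> 0 < theta ->
  ip u theta (fun p => gweight u theta p * field_value u A B p)
             (fun p => gweight u theta p * field_value u C D p) =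
  (besselK 1 theta^-1)^-1 * laplace theta^-1 (A * C + B * D * ('X^2 - 1)).
Proof.
move=> u1 theta0; have z0 : 0 < theta^-1 by rewrite invr_gt0.
set zeta := theta^-1 in z0 *.
rewrite /ip.
pose G p := gweight u theta p * (field_value u A B p * field_value u C D p) / p0 p.
have -> : \int[mu]_(p in [set: R]) (gweight u theta p * field_value u A B p *
    (gweight u theta p * field_value u C D p) / gweight u theta p / p0 p) =
  \int[mu]_p G p.
  apply: eq_Rintegral => p _; rewrite /G; congr (_ / _).
  by field; rewrite gt_eqF // gweight_gt0.
have cG : continuous G.
  move=> p; suff : G q @[q --> p] --> G p by [].
  apply: cvgM; last first.
    by apply: cvgV; [rewrite gt_eqF // p0_gt0|exact: continuous_p0].
  apply: cvgM; first exact: continuous_gweight.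
  by apply: cvgM; exact: continuous_field_value.
rewrite (integral_boost u1 cG).
have [K KE] : {K | K = besselK 1 zeta} by exists (besselK 1 zeta).
have K0 : K != 0 by rewrite KE gt_eqF // besselK1_gt0.
pose X := A * C + B * D * ('X^2 - 1); pose Y := A * D + B * C.
pose phi t := (2 * K)^-1 * (boltzmann zeta X t - boltzmann zeta Y t * sinh t).
have -> : (fun t => G (boost u t) * boost_energy u t) = phi.
  apply/funext => t; rewrite /G /field_value /slip p_proj_boost // energy_boost //.
  rewrite p0_boost // divfK ?gt_eqF ?boost_energy_gt0 //.
  rewrite /gweight energy_boost // -/zeta -KE /phi /boltzmann.
  rewrite -[LHS]mulrA; congr (_ * _); rewrite /X /Y.
  have X1 : ('X^2 - 1 : {poly R}).[cosh t] = sinh t ^+ 2.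
    by rewrite !hornerE /=; have := cosh_sqr t; lra.
  by rewrite !hornerD !hornerM X1; ring.
have cphi : continuous phi.
  move=> t; suff : phi s @[s --> t] --> phi t by [].
  apply: cvgM; first exact: cvg_cst.
  apply: cvgB; first exact: continuous_boltzmann.
  by apply: cvgM; [exact: continuous_boltzmann|exact: continuous_sinh].
have intX := integrable_boltzmann X z0.
have intY := integrable_boltzmann_sinh Y z0.
have phiN t : phi (- t)
  = (2 * K)^-1 * (boltzmann zeta X t + boltzmann zeta Y t * sinh t).
  by rewrite /phi /boltzmann coshN sinhN mulrN opprK.
have int_scale (f : R -> R) (c : R) : mu.-integrable `[0%R, +oo[ (EFin \o f) ->
    mu.-integrable `[0%R, +oo[ (EFin \o (fun t => c * f t)).
  move=> intf; have int_f : mu.-integrable `[0%R, +oo[ (fun t => c%:E * (f t)%:E)%E.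
    by apply: integrableZl.
  exact: int_f.
have int1 : mu.-integrable `[0%R, +oo[ (EFin \o phi).
  by apply: int_scale; exact: (integrableB _ intX intY).
have int2 : mu.-integrable `[0%R, +oo[ (EFin \o (phi \o -%R)).
  have -> : phi \o -%R = (fun t =>
    (2 * K)^-1 * (boltzmann zeta X t + boltzmann zeta Y t * sinh t)).
    by apply/funext => t; exact: phiN.
  by apply: int_scale; exact: (integrableD _ intX intY).
rewrite (Rintegral_fold cphi int1 int2) -KE /laplace -[RHS]RintegralZl //.
apply: eq_Rintegral => t _; rewrite phiN /phi.
by field.
Qed.

End KineticFields.

(** * Derivatives of the weight function in velocity and temperature *)

Section Derivatives.
Variable R : realType.
Implicit Types (f g : R -> R) (x a b : R).

Lemma derive_mul f g x a b : is_derive x 1 f a -> is_derive x 1 g b ->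
  is_derive x 1 (fun y => f y * g y) (a * g x + f x * b).
Proof.
move=> df dg; have := @is_deriveM _ _ f g x 1 a b df dg.
by move/is_derive_eq; apply; rewrite /GRing.scale /= addrC [g x * _]mulrC.
Qed.

Lemma derive_inv f x a : f x != 0 -> is_derive x 1 f a ->
  is_derive x 1 (fun y => (f y)^-1) (- a / f x ^+ 2).
Proof.
move=> fx0 df; apply: DeriveDef; first by apply: derivableV => //; exact: ex_derive.
by rewrite deriveV // derive_val /GRing.scale /= !mulNr mulrC.
Qed.

Lemma derive_comp f g x a b : is_derive (g x) 1 f a -> is_derive x 1 g b ->
  is_derive x 1 (fun y => f (g y)) (a * b).
Proof. by move=> df dg; exact: (is_derive1_comp df dg). Qed.

Lemma derive_add f g x a b : is_derive x 1 f a -> is_derive x 1 g b ->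
  is_derive x 1 (fun y => f y + g y) (a + b).
Proof. by move=> df dg; exact: is_deriveD. Qed.

Lemma derive_opp f x a : is_derive x 1 f a -> is_derive x 1 (fun y => - f y) (- a).
Proof. by move=> df; exact: is_deriveN. Qed.

Lemma derive_const (c x : R) : is_derive x 1 (fun=> c) 0.
Proof. exact: is_derive_cst. Qed.

Lemma derive_scale (c : R) f x a : is_derive x 1 f a ->
  is_derive x 1 (fun y => c * f y) (c * a).
Proof.
move=> df; have := derive_mul (derive_const c x) df.
by rewrite mul0r add0r.
Qed.

Lemma derive_id x : is_derive x 1 (fun y : R => y) 1.
Proof. exact: is_derive_id. Qed.

(** A derivative in a direction of the space of unknowns is taken along a
    line, where the calculus of functions of one real variable applies. *)
Lemma derive_line n (f : 'cV[R]_n.+1 -> R) (W v : 'cV[R]_n.+1) (d : R) :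
  is_derive (0 : R) 1 (fun h => f (h *: v + W)) d -> 'D_v f W = d.
Proof.
move=> df; have <- : 'D_1 (fun h : R => f (h *: v + W)) 0 = d by exact: derive_val.
rewrite /derive; set F := (X in lim (X @ _)); set G := (X in _ = lim (X @ _)).
suff -> : F = G by [].
apply/funext => h; rewrite /F /G /=.
by rewrite scale0r add0r addr0 /GRing.scale /= mulr1.
Qed.

(** Differentiation under the integral sign; for [z] near [zeta] the
    derivative of the integrand is dominated by its value at [zeta / 2]. *)
Lemma derive_besselK1 (zeta : R) : 0 < zeta ->
  is_derive zeta 1 (@besselK R 1) ('D_1 (@besselK R 1) zeta).
Proof.
move=> z0; apply: DeriveDef => //.
have -> : @besselK R 1 = (fun z =>
  \int[lebesgue_measure]_(t in `[0%R, +oo[) boltzmann z 'X t).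
  by apply/funext => z; exact: besselK1E.
have z2 : 0 < zeta / 2 by rewrite divr_gt0.
have dB (z t : R) : is_derive z 1 (fun z => boltzmann z 'X t) (- boltzmann z 'X^2 t).
  have d := derive_scale 'X.[cosh t] (derive_comp (is_derive_expR _)
    (derive_opp (derive_mul (derive_id z) (derive_const (cosh t) z)))).
  apply: (is_derive_eq d).
  by rewrite /boltzmann hornerX hornerXn; ring.
(* The interval (zeta / 2, 2 zeta) is a neighbourhood of zeta. *)
apply: (@derivable_under_integral R _ _ lebesgue_measure (fun z t => boltzmann z 'X t)
  `[0%R, +oo[ _ zeta (zeta / 2) (zeta * 2) _ _ _ (fun t =>
    boltzmann (zeta / 2) 'X^2 t)).
- exact: measurable_itv.
- by rewrite /= in_itv /=; apply/andP; split; lra.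
- move=> z; rewrite /= in_itv /= => /andP[zl _]; apply: integrable_boltzmann.
  exact: lt_trans zl.
- by move=> z t _ _; have := dB z t => dz; exact: ex_derive.
- by move=> t; rewrite /boltzmann mulr_ge0 ?expR_ge0 // hornerXn sqr_ge0.
- exact: integrable_boltzmann.
- move=> z t; rewrite /= in_itv /= => /andP[zl _] _.
  rewrite partial1of2E; have dz := dB z t;
    rewrite derive_val normrN /boltzmann hornerXn.
  rewrite ger0_norm ?mulr_ge0 ?sqr_ge0 ?expR_ge0 // ler_wpM2l ?sqr_ge0 //.
  by rewrite ler_expR lerN2 ler_wpM2r ?ltW // cosh_gt0.
Qed.

Lemma derive_U0 (u : R) : `|u| < 1 -> is_derive u 1 (@U0 R) (u * U0 u ^+ 3).
Proof.
move=> u1; have s0 : 0 < 1 - u ^+ 2.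
  by rewrite subr_gt0 -real_normK ?num_real // expr_lt1.
have r0 : 0 < Num.sqrt (1 - u ^+ 2) by rewrite sqrtr_gt0.
have d := @derive_inv (fun v =>
  Num.sqrt (1 - v ^+ 2)) _ _ (lt0r_neq0 r0) (@derive_comp _ (fun v => 1 - v ^+ 2) _ _ _
  (is_derive1_sqrt s0)
  (derive_add (derive_const 1 u) (derive_opp (derive_mul (derive_id u) (derive_id
    u))))).
apply: (is_derive_eq d); rewrite /U0.
by field; rewrite gt_eqF.
Qed.

Lemma derive_energy (u p : R) : `|u| < 1 ->
  is_derive u 1 (fun v => energy v p) (U0 u ^+ 2 * slip u p).
Proof.
move=> u1; have g0 := gamma_gt0 u1; have dU := derive_U0 u1.
have d := derive_add (derive_mul dU (derive_const (p0 p) u))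
  (derive_opp (derive_mul (derive_mul (derive_id u) dU) (derive_const p u))).
apply: (is_derive_eq d).
rewrite /slip /p_proj /energy /U1; field.
by rewrite gt_eqF.
Qed.

Lemma derive_gweight_velocity (u theta p : R) : `|u| < 1 ->
  is_derive u 1 (fun v => gweight v theta p)
    (gweight u theta p * (- (theta^-1 * U0 u ^+ 2) * slip u p)).
Proof.
move=> u1.
have d := derive_scale (2 * besselK 1 theta^-1)^-1 (derive_comp (is_derive_expR _)
  (derive_opp (derive_scale theta^-1 (derive_energy p u1)))).
by apply: (is_derive_eq d); rewrite /gweight; ring.
Qed.

(** The number [kappa] is the logarithmic derivative of the normalization
    [1 / K_1(1 / theta)]. *)
Lemma derive_gweight_temperature (u theta : R) : 0 < theta ->
  exists kappa, forall p, is_derive theta 1 (fun s => gweight u s p)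
    (gweight u theta p * (kappa + theta^-1 ^+ 2 * energy u p)).
Proof.
move=> t0; have z0 : 0 < theta^-1 by rewrite invr_gt0.
have K0 := besselK1_gt0 z0; have dK := derive_besselK1 z0.
have dV : is_derive theta 1 (fun s : R => s^-1) (- 1 / theta ^+ 2).
  exact: (@derive_inv (fun s => s) _ _ (lt0r_neq0 t0) (derive_id theta)).
have dk := @derive_comp _ (fun s : R => s^-1) _ _ _ dK dV.
exists ('D_1 (@besselK R 1) theta^-1 / theta ^+ 2 / besselK 1 theta^-1) => p.
have K20 : 2 * besselK 1 theta^-1 != 0 by rewrite mulf_neq0 // gt_eqF.
have d := derive_mul (@derive_inv (fun s =>
  2 * besselK 1 s^-1) _ _ K20 (derive_scale 2 dk))
  (derive_comp (is_derive_expR _)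
    (derive_opp (derive_mul dV (derive_const (energy u p) theta)))).
apply: (is_derive_eq d); rewrite /gweight.
have th0 : theta != 0 by rewrite gt_eqF.
move: K0 => /lt0r_neq0 K0.
by field; rewrite K0 th0.
Qed.

End Derivatives.

(** * The linearized system at an equilibrium *)

Section LinearizedSystem.
Variable R : realType.

Lemma moment_functional (zeta : R) : 0 < zeta ->
  exists Lam : nat -> {scalar {poly R}},
  [/\ forall l q, Lam l q = (besselK 1 zeta)^-1 * laplace zeta (q * ('X^2 - 1) ^+ l),
      forall l f g, (l < 2)%N -> weight_ip l zeta f g = Lam l (f * g),
      forall q, Lam 1 q = Lam 0 (q * ('X^2 - 1))
    & positive_on_ray (Lam 0)].
Proof.
move=> z0.
pose L l (q : {poly R}) : R := (besselK 1 zeta)^-1 * laplace zeta (q * ('X^2 - 1) ^+ l).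
have linL l : linear_for *%R (L l).
  move=> a p q; rewrite /L mulrDl -scalerAl laplace_linear //= /GRing.scale /=.
  by rewrite mulrDr mulrCA.
pose Lam l : {scalar {poly R}} :=
  HB.pack (L l) (GRing.isLinear.Build _ _ _ _ (L l) (linL l)).
exists Lam; split => //.
- by move=> l f g l2; rewrite weight_ipE.
- by move=> q; rewrite /= /L expr1 expr0 mulr1.
- move=> q q0 qpos; rewrite /= /L expr0 mulr1 mulr_gt0 ?invr_gt0 ?besselK1_gt0 //.
  exact: laplace_pos.
Qed.

Lemma lcoef_pos (zeta : R) l n : 0 < zeta -> (l < 2)%N -> 0 < lcoef l zeta n.
Proof.
move=> /moment_functional[Lam [_ wE L1 pos]]; exact: (lcoef_gt0 wE L1 pos).
Qed.

Lemma orthopoly_const (zeta : R) l : 0 < zeta -> (l < 2)%N ->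
  orthopoly l zeta 0 = (lcoef l zeta 0)%:P.
Proof.
move=> /moment_functional[Lam [_ wE L1 pos]]; exact: (orthopoly0E wE L1 pos).
Qed.

Lemma orthopoly_linear (zeta : R) l : 0 < zeta -> (l < 2)%N ->
  orthopoly l zeta 1 = lcoef l zeta 1 *: 'X + ((orthopoly l zeta 1)`_0)%:P.
Proof.
move=> /moment_functional[Lam [_ wE L1 pos]] l2.
have size1 := size_orthopoly wE L1 pos 1 l2.
rewrite -{1}(orthopoly_top wE L1 pos 1 l2); apply/polyP => i.
rewrite coefD coefZ coefX coefC; case: i => [|[|i]] /=.
- by rewrite mulr0 add0r.
- by rewrite mulr1 addr0.
- by rewrite mulr0 addr0 nth_default // size1.
Qed.

Lemma orthonormal_components (zeta : R) (Lam : nat -> {scalar {poly R}}) (i k : nat) :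
  (forall l f g, (l < 2)%N -> weight_ip l zeta f g = Lam l (f * g)) ->
  (forall q, Lam 1 q = Lam 0 (q * ('X^2 - 1))) -> positive_on_ray (Lam 0) ->
  Lam 0 (comp0 zeta (interlaced i) * comp0 zeta (interlaced k)) +
  Lam 1 (comp1 zeta (interlaced i) * comp1 zeta (interlaced k)) = (i == k)%:R.
Proof.
move=> wE L1 pos.
have [_ _ o0] := orthopoly_orthonormal wE L1 pos (isT : (0 < 2)%N).
have [_ _ o1] := orthopoly_orthonormal wE L1 pos (isT : (1 < 2)%N).
rewrite -(inj_eq interlaced_inj) /comp0 /comp1.
have : ((interlaced i).1 < 2)%N by rewrite /interlaced; case: ifP.
have : ((interlaced k).1 < 2)%N by rewrite /interlaced; case: ifP.
case: (interlaced i) => [[|[|//]] m] /=; case: (interlaced k) => [[|[|//]] n] //= _ _.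
- by rewrite mulr0 linear0 addr0 o0.
- by rewrite mulr0 mul0r !linear0 addr0.
- by rewrite mulr0 mul0r !linear0 addr0.
- by rewrite mulr0 linear0 add0r o1.
Qed.

Lemma basisME M (i : 'I_(dimW M)) (u theta p : R) :
  basisM i u theta p = gweight u theta p *
    field_value u (comp0 theta^-1 (interlaced i)) (comp1 theta^-1 (interlaced i)) p.
Proof.
rewrite /basisM /wpoly /field_value /comp0 /comp1 -mulrA; congr (_ * _).
have : ((interlaced i).1 < 2)%N by rewrite /interlaced; case: ifP.
case: (interlaced i) => [[|[|//]] m] /= _.
  by rewrite expr0 mulr1 horner0 mul0r addr0.
by rewrite expr1 horner0 add0r.
Qed.

(** The leading coefficient c_0 of the basis cancels that of D^W.  In this
    form the expansion can be differentiated in theta without differentiating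
    the orthonormal polynomials. *)
Lemma expansion_local_equilibrium M (V : 'cV[R]_(dimW M)) (p : R) :
  0 < temperature V -> (forall j : 'I_(dimW M), (2 < j)%N -> V j 0 = 0) ->
  expansion V p = V ord0 0 * gweight (velocity V) (temperature V) p.
Proof.
move=> t0 V0; have z0 : 0 < (temperature V)^-1 by rewrite invr_gt0.
have coefE (i : 'I_(dimW M)) : (DW_mx M (temperature V) *m V) i 0 =
    if i == ord0 then (lcoef 0 (temperature V)^-1 0)^-1 * V ord0 0 else 0.
  rewrite mxE (bigD1 ord0) //= big1 ?addr0 => [|j j0].
    rewrite mxE; case: eqP => [->//|/eqP].
    rewrite -val_eqE /=; case: (nat_of_ord i) => [|[|[|[|[|m]]]]] //= _;
      by rewrite mul0r.
  have [j2|j2] := ltnP 2 j; first by rewrite V0 // mulr0.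
  rewrite mxE -val_eqE /= in j0 *; move: j2 j0.
  case: (nat_of_ord j) => [|[|[|]]] //= _ _;
    by case: (nat_of_ord i) => [|[|[|[|[|m]]]]] //=; rewrite mul0r.
rewrite /expansion (bigD1 ord0) //= coefE eqxx big1 ?addr0 => [|i i0]; last first.
  by rewrite coefE (negPf i0) mulr0.
rewrite /basisM /wpoly /= expr0 mulr1 orthopoly_const // hornerC.
have c0 := lcoef_pos 0 z0 (isT : (0 < 2)%N).
by field; rewrite gt_eqF.
Qed.

Section AtEquilibrium.
Variables (M : nat) (rho u theta : R).
Hypothesis M_gt0 : (0 < M)%N.
Hypothesis rho_gt0 : 0 < rho.
Hypothesis u_lt1 : `|u| < 1.
Hypothesis theta_gt0 : 0 < theta.

Local Notation W := (equilibrium M rho u theta).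
Local Notation zeta := (theta^-1).
Local Notation perturbed j h := (h *: delta_mx j 0 + W).

Let zeta_gt0 : 0 < zeta. Proof. by rewrite invr_gt0. Qed.

Lemma perturbedE (i j : 'I_(dimW M)) (h : R) :
  (perturbed j h) i 0 = h * (i == j)%:R + W i 0.
Proof. by rewrite !mxE andbT. Qed.

Let idx1 : nat_of_ord (inord 1 : 'I_(dimW M)) = 1%N.
Proof. by have lt1 : (1 < dimW M)%N by [lia]; exact: inordK lt1. Qed.
Let idx2 : nat_of_ord (inord 2 : 'I_(dimW M)) = 2%N.
Proof. by have lt2 : (2 < dimW M)%N by [lia]; exact: inordK lt2. Qed.

Lemma velocity_perturbed (j : 'I_(dimW M)) (h : R) :
  velocity (perturbed j h) = h * (1 == j :> nat)%:R + u.
Proof. by rewrite /velocity perturbedE mxE idx1 -val_eqE /= idx1. Qed.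

Lemma temperature_perturbed (j : 'I_(dimW M)) (h : R) :
  temperature (perturbed j h) = h * (2 == j :> nat)%:R + theta.
Proof. by rewrite /temperature perturbedE mxE idx2 -val_eqE /= idx2. Qed.

Lemma density_perturbed (j : 'I_(dimW M)) (h : R) : j != ord0 ->
  (perturbed j h) ord0 0 = rho.
Proof. by move=> j0; rewrite perturbedE eq_sym (negPf j0) mulr0 add0r mxE. Qed.

Lemma velocity_equilibrium : velocity W = u.
Proof. by rewrite /velocity mxE idx1. Qed.

Lemma temperature_equilibrium : temperature W = theta.
Proof. by rewrite /temperature mxE idx2. Qed.

Lemma perturbed_high (i j : 'I_(dimW M)) (h : R) : (j < 3)%N -> (2 < i)%N ->
  (perturbed j h) i 0 = 0.
Proof.
move=> j3 i2; have ji : (j < i)%N by exact: leq_trans i2.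
rewrite perturbedE -val_eqE /= (gtn_eqF ji) mulr0 add0r.
by rewrite mxE; case: (nat_of_ord i) i2 => [|[|[|]]].
Qed.

Lemma sum_pick (F : 'I_(dimW M) -> R) (e : nat -> R) (k : 'I_(dimW M)) :
  (forall i : 'I_(dimW M), i != k -> e i = 0) ->
  \sum_(i < dimW M) e i * F i = e k * F k.
Proof.
by move=> e0; rewrite (bigD1 k) //= big1 ?addr0 // => i /e0 ->; rewrite mul0r.
Qed.

Lemma derivative_moment (j : 'I_(dimW M)) (p : R) : (nat_of_ord j != 1)%N ->
  (nat_of_ord j != 2)%N ->
  'D_(delta_mx j 0) (fun V : 'cV[R]_(dimW M) => expansion V p) W =
  \sum_(i < dimW M) DW_entry zeta i j * basisM i u theta p.
Proof.
move=> j1 j2; apply: derive_line.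
set A := \sum_(i < _) _.
pose B := \sum_(i < dimW M) basisM i u theta p * (DW_mx M theta *m W) i 0.
have -> : (fun h : R => expansion (perturbed j h) p) = (fun h => A * h + B).
  apply/funext => h; rewrite /expansion velocity_perturbed temperature_perturbed.
  rewrite ![_ == nat_of_ord j]eq_sym (negPf j1) (negPf j2) mulr0 !add0r.
  rewrite /A /B mulr_suml -big_split /=; apply: eq_bigr => i _.
  have -> : (DW_mx M theta *m perturbed j h) i 0 =
      h * DW_entry zeta i j + (DW_mx M theta *m W) i 0.
    rewrite mulmxDr -scalemxAr -colE [LHS]mxE; congr (_ + _).
    by rewrite !mxE.
  by ring.
have d := derive_add (derive_scale A (derive_id 0)) (derive_const B 0).
by apply: (is_derive_eq d); rewrite mulr1 addr0.
Qed.

Lemma derivative_velocity (j : 'I_(dimW M)) (p : R) : nat_of_ord j = 1%N ->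
  'D_(delta_mx j 0) (fun V : 'cV[R]_(dimW M) => expansion V p) W =
  rho * (gweight u theta p * (- (zeta * U0 u ^+ 2) * slip u p)).
Proof.
move=> j1; apply: derive_line.
have j0 : j != ord0 by rewrite -val_eqE /= j1.
have -> : (fun h : R => expansion (perturbed j h) p) =
          (fun h => rho * gweight (h + u) theta p).
  apply/funext => h; rewrite expansion_local_equilibrium.
  - by rewrite density_perturbed // velocity_perturbed temperature_perturbed j1 mulr1
    mulr0 add0r.
  - by rewrite temperature_perturbed j1 mulr0 add0r.
  - by move=> i; apply: perturbed_high; rewrite j1.
have d1 : is_derive (0 + u) 1 (fun v => gweight v theta p)
    (gweight u theta p * (- (zeta * U0 u ^+ 2) * slip u p)).
  by rewrite add0r; exact: derive_gweight_velocity.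
have d := derive_scale rho (@derive_comp _ _ (fun h => h + u) _ _ _ d1
  (derive_add (derive_id 0) (derive_const u 0))).
by apply: (is_derive_eq d); rewrite addr0 mulr1.
Qed.

Lemma derivative_temperature (j : 'I_(dimW M)) : nat_of_ord j = 2%N ->
  exists kappa, forall p,
  'D_(delta_mx j 0) (fun V : 'cV[R]_(dimW M) => expansion V p) W =
  rho * (gweight u theta p * (kappa + zeta ^+ 2 * energy u p)).
Proof.
move=> j2; have [kappa dk] := derive_gweight_temperature u theta_gt0.
exists kappa => p; apply: derive_line.
have j0 : j != ord0 by rewrite -val_eqE /= j2.
have d1 : is_derive (0 + theta) 1 (fun s => gweight u s p)
    (gweight u theta p * (kappa + zeta ^+ 2 * energy u p)).
  by rewrite add0r; exact: dk.
have d := derive_scale rho (@derive_comp _ _ (fun h => h + theta) _ _ _ d1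
  (derive_add (derive_id 0) (derive_const theta 0))).
(* The closed form of the expansion holds as long as the temperature is
   positive, hence only near h = 0. *)
apply: (near_eq_is_derive _ (is_derive_eq d _)); last by rewrite addr0 mulr1.
have : \forall h \near (0 : R), - theta < h.
  by apply: lt_nbhsr; rewrite oppr_lt0.
apply: filterS => h ht; have ht0 : 0 < h + theta by lra.
rewrite expansion_local_equilibrium.
- by rewrite density_perturbed // velocity_perturbed temperature_perturbed j2 mulr1
  mulr0 add0r.
- by rewrite temperature_perturbed j2 mulr1.
- by move=> i; apply: perturbed_high; rewrite j2.
Qed.

(** The derivative in u is proportional to p_<1> g and the one in theta is g
    times a polynomial of degree 1 in E; the constants [a], [b] and [c] express
    them on the weighted basis. *)
Lemma derivative_expansion : exists a b c : R, [/\ a != 0, c != 0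
  & forall (j : 'I_(dimW M)) p,
    'D_(delta_mx j 0) (fun V : 'cV[R]_(dimW M) => expansion V p) W =
    \sum_(i < dimW M) equilibrium_entry zeta a b c i j * basisM i u theta p].
Proof.
have g0 := gamma_gt0 u_lt1.
have c00 := lcoef_pos 0 zeta_gt0 (isT : (0 < 2)%N).
have c01 := lcoef_pos 1 zeta_gt0 (isT : (0 < 2)%N).
have c10 := lcoef_pos 0 zeta_gt0 (isT : (1 < 2)%N).
have [kappa dk] := derivative_temperature idx2.
(* The coefficient c compares the terms in E, and b the remaining constants. *)
pose a := - (rho * zeta * U0 u ^+ 2 / lcoef 1 zeta 0).
pose c := rho * zeta ^+ 2 / lcoef 0 zeta 1.
pose b := (rho * kappa - c * (orthopoly 0 zeta 1)`_0) / lcoef 0 zeta 0.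
exists a, b, c; split.
- by rewrite oppr_eq0 gt_eqF // divr_gt0 // !mulr_gt0 // exprn_gt0.
- by rewrite gt_eqF // divr_gt0 // mulr_gt0 // exprn_gt0.
move=> j p.
have [j1|j1] := eqVneq (nat_of_ord j) 1%N.
  rewrite derivative_velocity // j1.
  rewrite (@sum_pick _ (fun i => equilibrium_entry zeta a b c i 1) (inord 2));
    last first.
    move=> i; rewrite -val_eqE /= idx2 => /negPf i2.
    by rewrite /equilibrium_entry i2.
  rewrite idx2 /= basisME idx2 /field_value /comp0 /comp1 /= horner0 add0r.
  rewrite orthopoly_const // hornerC /a; field.
  by rewrite !gt_eqF.
have [j2|j2] := eqVneq (nat_of_ord j) 2%N.
  have -> : j = inord 2 by apply: val_inj; rewrite /= idx2.
  rewrite dk idx2.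
  rewrite (bigD1 ord0) // (bigD1 (inord 1)) /=; last by rewrite -val_eqE /= idx1.
  rewrite big1 ?addr0; last first.
    move=> i; rewrite -!val_eqE /= idx1 => /andP[/negPf i0 /negPf i1].
    by rewrite /equilibrium_entry i0 i1 mul0r.
  rewrite idx1 /= !basisME idx1 /field_value /comp0 /comp1 /= horner0 !mul0r !addr0.
  rewrite orthopoly_const // hornerC orthopoly_linear // hornerD hornerZ hornerX
    hornerC.
  rewrite /b /c; field.
  by rewrite (lt0r_neq0 c00) (lt0r_neq0 c01) (lt0r_neq0 theta_gt0).
rewrite derivative_moment //; apply: eq_bigr => i _; congr (_ * _).
by move: j1 j2; case: (nat_of_ord j) => [|[|[|]]].
Qed.

(** The derivatives of the expansion lie in the span of the weighted basis,
    so their coefficients are read off by orthonormality. *)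
Lemma D_mx_equilibrium : exists a b c : R, [/\ a != 0, c != 0
  & forall i j, D_mx W i j = equilibrium_entry zeta a b c i j].
Proof.
have [a [b [c [a0 c0 dE]]]] := derivative_expansion.
exists a, b, c; split=> // k j.
have [Lam [LamE wE L1 pos]] := moment_functional zeta_gt0.
pose e (i : 'I_(dimW M)) : R := equilibrium_entry zeta a b c i j.
pose A := \sum_(i < dimW M) e i *: comp0 zeta (interlaced i).
pose B := \sum_(i < dimW M) e i *: comp1 zeta (interlaced i).
rewrite mxE velocity_equilibrium temperature_equilibrium.
transitivity (ip u theta (fun p => gweight u theta p * field_value u A B p)
  (fun p => gweight u theta p * field_value u (comp0 zeta (interlaced k))
                                              (comp1 zeta (interlaced k)) p)).
  rewrite /ip; apply: eq_Rintegral => p _; rewrite dE basisME.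
  congr (_ * _ / _ / _); rewrite /field_value /A /B !horner_sum mulr_suml -big_split /=.
  rewrite mulr_sumr; apply: eq_bigr => i _.
  by rewrite basisME /field_value !hornerZ /e; ring.
rewrite kinetic_ip // -[X in laplace _ X]mulr1 -(expr0 ('X^2 - 1)) -LamE linearD /=.
rewrite -L1 /A /B !mulr_suml !linear_sum -big_split /= (bigD1 k) //= big1 ?addr0.
  rewrite -!scalerAl !linearZ /= -mulrDr (orthonormal_components k k wE L1 pos).
  by rewrite eqxx mulr1.
move=> i ik; rewrite -!scalerAl !linearZ /= -mulrDr.
rewrite (orthonormal_components i k wE L1 pos) val_eqE (negPf ik) mulr0 //.
Qed.

End AtEquilibrium.

End LinearizedSystem.

Local Close Scope classical_set_scope.

Theorem theorem5p4 (R : realType) (M : nat) (tau rho0 u0 theta0 : R)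
    (hM : (1 <= M)%N) (htau : 0 < tau)
    (hrho : 0 < rho0) (hu : `|u0| < 1) (htheta : 0 < theta0) :
  (forall (k : R) (omega : R[i]),
      dispersion tau (equilibrium M rho0 u0 theta0) omega (real_complex R k) = 0 ->
      0 <= complex.Im omega)
  /\
  (forall (omega : R) (k : R[i]), 0 < omega ->
      dispersion tau (equilibrium M rho0 u0 theta0) (real_complex R omega) k = 0 ->
      complex.Re k * complex.Im k <= 0).
Proof.
have zeta_gt0 : 0 < theta0^-1 by rewrite invr_gt0.
have [Lam [_ weightE Lam1E Lam_pos]] := moment_functional zeta_gt0.
have [a [b [c [a0 c0 DE]]]] := D_mx_equilibrium hM hrho hu htheta.
have vel : velocity (equilibrium M rho0 u0 theta0) = u0.
  exact: velocity_equilibrium.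
have temp : temperature (equilibrium M rho0 u0 theta0) = theta0.
  exact: temperature_equilibrium.
split=> [k omega disp|omega k omega_gt0 disp].
  have [m [x [r [m0 r0 E]]]] := dispersion_equilibrium weightE Lam1E Lam_pos
    hM htau hu erefl vel temp a0 c0 DE disp.
  exact: (scalar_stability_time m0 r0 E).
have [m [x [r [m0 r0 E]]]] := dispersion_equilibrium weightE Lam1E Lam_pos
  hM htau hu erefl vel temp a0 c0 DE disp.
exact: (scalar_stability_space m0 r0 omega_gt0 E).
Qed.
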